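(* Let $\alpha\vdash k$. Then for every integer $n\geq k$, $$ N(n;\alpha) = \sum_{j=0}^k \frac{t_{n-j}}{(k-j)!}\sum_{\substack{\mu\vdash j\\ m_1(\mu)=m_2(\mu)=0}} z_\mu^{-1}\,\chi^\alpha(\tilde{\mu},1^{k-j}). $$
   Context: A standard Young tableau (SYT) of (possibly skew) shape is a filling of the cells of the diagram by $1,2,\dots$ (each once) increasing along rows and down columns. For a partition $\alpha\vdash k$ and a fixed SYT $T$ of shape $\alpha$, $N(n;\alpha)$ denotes the number of SYT with $n$ cells that contain $T$ as a subtableau (i.e. whose entries $1,\dots,k$ form exactly $T$); this depends only on $\alpha$, and equals $\sum_{\lambda\vdash n} f^{\lambda/\alpha}$, where $f^{\lambda/\alpha}$ is the number of SYT of skew shape $\lambda/\alpha$ (zero if $\alpha\not\subseteq\lambda$). $t_m$ denotes the number of involutions in the symmetric group $\mathfrak{S}_m$. $\chi^\alpha(\rho)$ is the value of the irreducible character $\chi^\alpha$ of $\mathfrak{S}_k$ on a permutation of cycle type $\rho\vdash k$. $m_i(\mu)$ is the number of parts of $\mu$ equal to $i$, and $z_\mu=\prod_i i^{m_i(\mu)}m_i(\mu)!$ (so $z_\emptyset=1$). For a partition $\mu$, $\tilde{\mu}$ is the partition obtained by replacing every even part $2i$ by two parts $i,i$ (equivalently, if $w$ has cycle type $\mu$ then $w^2$ has cycle type $\tilde\mu$). $(\tilde{\mu},1^{k-j})$ denotes the partition consisting of the parts of $\tilde\mu$ together with $k-j$ additional parts equal to $1$. *)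

(* Defs.v *)
From HB Require Import structures.
From mathcomp Require Import all_boot all_order all_algebra.
From mathcomp Require Import all_fingroup all_solvable all_field all_character.

Set Implicit Arguments.
Unset Strict Implicit.
Unset Printing Implicit Defensive.

Import GroupScope GRing.Theory.

Local Open Scope nat_scope.

Definition is_part (s : seq nat) : bool := sorted geq s && (0 \notin s).

Record intpartn (n : nat) := IntPartn {
  parts :> seq nat;
  _ : is_part parts && (sumn parts == n)
}.

HB.instance Definition _ n := [isSub for @parts n].
HB.instance Definition _ n := [Countable of intpartn n by <:].

Definition strictly_below (r s : seq nat) : bool :=
  (size s <= size r) && all (fun j => nth 0 r j < nth 0 s j) (iota 0 (size s)).

(* A tableau is the list of its rows, so its shape is [shape t] from seq. *)
Definition is_syt (n : nat) (t : seq (seq nat)) : bool :=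
  [&& is_part (shape t), all (sorted ltn) t, sorted strictly_below t
    & perm_eq (flatten t) (iota 1 n)].

Record syt (n : nat) := Syt {
  rows :> seq (seq nat);
  _ : is_syt n rows
}.

HB.instance Definition _ n := [isSub for @rows n].
HB.instance Definition _ n := [Countable of syt n by <:].

Lemma size_le_sumn (s : seq nat) : 0 \notin s -> size s <= sumn s.
Proof.
elim: s => //= x s IH; rewrite inE negb_or eq_sym -lt0n => /andP[x0 /IH].
by move=> H; rewrite -add1n leq_add.
Qed.

Lemma mem_le_sumn (s : seq nat) x : x \in s -> x <= sumn s.
Proof.
elim: s => //= y s IH; rewrite inE => /orP[/eqP->|/IH H]; first exact: leq_addr.
exact: leq_trans H (leq_addl _ _).
Qed.

Lemma insub_bseqK n A (s : seq A) : size s <= n -> insub_bseq n s = s :> seq A.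
Proof. by move=> sz; rewrite /insub_bseq /insubd insubT. Qed.

Definition box n (s : seq nat) : n.-bseq 'I_n.+1 :=
  insub_bseq n (map (@inord n) s).

Lemma boxK n (s : seq nat) :
  size s <= n -> {in s, forall x, x <= n} -> map val (box n s) = s.
Proof.
move=> sz le_n; rewrite insub_bseqK ?size_map // -map_comp -[RHS]map_id.
by apply/eq_in_map => x xs /=; rewrite inordK // ltnS le_n.
Qed.

Lemma intpartn_pcan n :
  pcancel (fun mu : intpartn n => box n mu)
          (fun b => insub (map val b) : option (intpartn n)).
Proof.
move=> mu; have := valP mu => /andP[/andP[_ s0] /eqP smu].
rewrite boxK ?valK //; first by rewrite -[X in _ <= X]smu size_le_sumn.
by move=> x /mem_le_sumn; rewrite smu.
Qed.

HB.instance Definition _ n : isFinite (intpartn n) :=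
  PCanIsFinite (@intpartn_pcan n).

Lemma syt_pcan n :
  pcancel (fun t : syt n => insub_bseq n (map (box n) t))
          (fun b : n.-bseq (n.-bseq 'I_n.+1) =>
             insub (map (fun r : n.-bseq 'I_n.+1 => map val r) b)
               : option (syt n)).
Proof.
move=> t; have /and4P[/andP[_ s0] _ _ tn] := valP t.
have sz_t : sumn (shape t) = n by rewrite -size_flatten (perm_size tn) size_iota.
have sz : size (map (box n) t) <= n.
  by rewrite size_map -(size_map size) -[X in _ <= X]sz_t size_le_sumn.
rewrite insub_bseqK // -map_comp.
have -> : map ((fun r : n.-bseq 'I_n.+1 => map val r) \o box n) t = t :> seq _.
  rewrite -[RHS]map_id; apply/eq_in_map => r rt /=; apply: boxK.
    by rewrite -[X in _ <= X]sz_t; apply/mem_le_sumn/map_f.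
  move=> x xr; suff: x \in iota 1 n by rewrite mem_iota add1n ltnS => /andP[].
  by rewrite -(perm_mem tn); apply/flattenP; exists r.
by rewrite valK.
Qed.

HB.instance Definition _ n : isFinite (syt n) :=
  PCanIsFinite (@syt_pcan n).

(* When t is an SYT this keeps the cells with entries at most k in place: they
   are left-justified initial segments of the topmost rows. *)
Definition subtableau (k : nat) (t : seq (seq nat)) : seq (seq nat) :=
  [seq r <- [seq [seq x <- r | x <= k] | r <- t] | r != [::]].

Definition nb_syt_containing (n k : nat) (T : syt k) : nat :=
  #|[set S : syt n | subtableau k S == T]|.

(* The identity counts as an involution. *)
Definition nb_involutions (m : nat) : nat := #|[set s : 'S_m | (s * s == 1)%g]|.

Definition zpart (mu : seq nat) : nat :=
  \prod_(1 <= i < (sumn mu).+1) (i ^ count_mem i mu * (count_mem i mu)`!).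

Definition square_type (mu : seq nat) : seq nat :=
  flatten [seq if odd p then [:: p] else [:: p./2; p./2] | p <- mu].

(* Cycle types, fixed points included, are compared up to reordering. *)
Definition cycle_type (k : nat) (s : 'S_k) : seq nat :=
  [seq #|C| | C : {set 'I_k} <- enum (porbits s)].

Section Specht.

Variables (k : nat) (alpha : intpartn k).

(* The cells of alpha are numbered 0, ..., k-1 row by row; reshape_index and
   reshape_offset give the row and the column of a cell. *)
Definition row_stab : {set 'S_k} :=
  [set s : 'S_k |
    [forall i, reshape_index alpha (s i) == reshape_index alpha i]].

Definition col_stab : {set 'S_k} :=
  [set s : 'S_k |
    [forall i, reshape_offset alpha (s i) == reshape_offset alpha i]].

Definition gring_elt (s : 'S_k) : 'rV[algC]_#|[set: 'S_k]| :=
  delta_mx 0%R (gring_index [set: 'S_k] s).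

Definition young_symmetrizer : 'rV[algC]_#|[set: 'S_k]| :=
  (\sum_(p in row_stab) \sum_(q in col_stab)
     (-1) ^+ odd_perm q *: gring_elt (p * q)%g)%R.

(* MathComp modules are right modules, so the Specht module is the right ideal
   generated by the Young symmetrizer. *)
Definition specht_repr :=
  submod_repr
    (cyclic_mx_module (regular_repr algC [set: 'S_k]) young_symmetrizer).

Definition specht_char : 'CF([set: 'S_k]) := cfRepr specht_repr.

(* The value of the class function specht_char at cycle type rho. *)
Definition specht_char_at (rho : seq nat) : algC :=
  if [pick s : 'S_k | perm_eq (cycle_type s) rho] is Some s
  then specht_char s else 0%R.

End Specht.

(* Main.v *)
(* Writing c_alpha = A B for the Young symmetrizer (A the row sum, B the signed
   column sum), everything about Specht characters follows from the sandwich
   identity A g B = c_alpha(g) A B, in the regular representation, where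
   inversion of group elements is transposition of matrices: c_alpha^2 =
   m c_alpha, irreducibility, the fact that the Frobenius-Schur indicator is 1,
   and the branching rule.  For the latter, only the non-vanishing of the
   multiplicities ('chi_beta, Ind chi_alpha) for alpha covered by beta is
   computed; the equality DU - UD = 1 in Young's lattice then leaves no room for
   other constituents by a dimension count.

   Consequently X_alpha(n) = (1/k!) sum_w chi^alpha(w) #{u in S_n | u^2 = w}
   satisfies X_alpha(n) = sum_(beta covers alpha) X_beta(n) and X_alpha(k) = 1,
   exactly like N(n; alpha).  Finally a square root u of w in S_k splits as an
   involution times the product v of its cycles of length at least 3, which lies
   in S_k; grouping the v's by cycle type gives the formula. *)

Require Import Defs.
From mathcomp Require Import all_boot all_order all_algebra.
From mathcomp Require Import all_fingroup all_solvable all_field all_character.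
From mathcomp Require Import ring zify.

Set Implicit Arguments.
Unset Strict Implicit.
Unset Printing Implicit Defensive.

Import Order.TTheory GRing.Theory Num.Theory.

Local Open Scope ring_scope.

(** * Modules generated by quasi-idempotents *)

(** X_alpha(n) is the inner product of chi^alpha with the restriction to S_k of the function
    counting square roots in S_n. Since every irreducible character of S_n has indicator 1, that
    function is the sum of all of them, which is why X_alpha(n) behaves like a path count in Young's
    lattice. The expansion itself is avoided: the recursion raises k with n fixed and stops at k =
    n, where the indicator of a single character suffices. If y y = m y with m nonzero, the right
    ideal generated by y is the image of left multiplication by y, so its character is a normalized
    trace, and the inner product of two such characters is the normalized trace of x |-> y x z. This
    operator is again a quasi-idempotent, hence its trace is a nonzero multiple of its rank, and one
    nonzero product y g z makes a multiplicity nonzero. Such information yields only inequalities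
    between dimensions, one for induction and one for restriction; composing them around Young's
    lattice turns both into equalities. *)

(** Factor [A = C *m R] through its rank. Cancelling [C] on the left and [R] on the right of
    [A *m A = m *: A] leaves [R *m C = m%:M], which has the same trace as [A]. *)
Lemma mxtrace_quasi_idem (F : fieldType) n (A : 'M[F]_n) m :
  A *m A = m *: A -> \tr A = m * (\rank A)%:R.
Proof.
move=> AA; set C := col_base A; set R := row_base A.
have defA : C *m R = A := mulmx_base A.
have RC : R *m C = m%:M.
  apply: (row_free_inj (row_base_free A)); rewrite -/R.
  apply: (row_full_inj (col_base_full A)); rewrite -/C.
  transitivity (A *m A); first by rewrite -[in RHS]defA !mulmxA.
  by rewrite AA mul_scalar_mx -scalemxAr defA.
by rewrite -[X in \tr X]defA mxtrace_mulC RC mxtrace_scalar mulr_natr.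
Qed.

(** [m^-1 *: E] is a projection onto [U] commuting with the action of [g], so the trace on [U] is
    the trace of [g] cut down by it. Factoring [E] through coordinates on [U] reduces this to the
    cyclic invariance of the trace. *)
Lemma trace_submod (F : fieldType) (gT : finGroupType) (H : {group gT}) n
    (rG : mx_representation F H n) (U E : 'M[F]_n) (modU : mxmodule rG U) g
    (m : F) :
    m != 0 -> E *m E = m *: E -> (E :=: U)%MS ->
    E *m rG g = rG g *m E ->
  \tr (submod_repr modU g) = m^-1 * \tr (E *m rG g).
Proof.
move=> m0 EE EU comm.
have EW p (W : 'M_(p, n)) : (W <= U)%MS -> W *m E = m *: W.
  by rewrite -EU => /submxP[D ->]; rewrite -mulmxA EE -scalemxAr.
have sEU : (E <= U)%MS by rewrite EU.
pose V := val_submod (1%:M : 'M_(\rank U)).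
pose D := in_submod U E.
have defE : E = D *m V by rewrite -val_submodE in_submodK.
have inD p (W : 'M_(p, n)) : in_submod U (W *m E) = W *m D.
  by rewrite in_submodE -mulmxA -in_submodE.
have -> : submod_repr modU g = in_submod U (V *m rG g) by [].
have VgE : V *m rG g *m E = m *: (V *m rG g).
  by rewrite -mulmxA -comm mulmxA (EW _ V (val_submodP _)) -scalemxAl.
apply: (mulfI m0); rewrite mulVKf // -mxtraceZ.
have -> : m *: in_submod U (V *m rG g) = (V *m rG g) *m D.
  by rewrite -inD VgE linearZ.
by rewrite mxtrace_mulC mulmxA -defE.
Qed.

(** * Traces in the regular representation *)

Section GroupAlgebra.

Variable gT : finGroupType.
Local Notation G := [set: gT]%G.
Local Notation N := #|[set: gT]|.
Local Notation aG := (regular_repr algC [set: gT]).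
Local Notation idx := (gring_index [set: gT]).

Lemma sum_enum_val (V : nmodType) (F : gT -> V) :
  \sum_(i < N) F (enum_val i) = \sum_g F g.
Proof.
rewrite -(big_enum_val (fun g => F g)) /=.
by apply: eq_bigl => g; rewrite inE.
Qed.

Lemma regular_reprM g h : aG (g * h)%g = aG g *m aG h.
Proof. by rewrite repr_mxM ?inE. Qed.

Lemma gring_idx_eq g h : (idx g == idx h) = (g == h).
Proof. by rewrite (can_in_eq gring_indexK) ?inE. Qed.

Lemma regular_trmx g : (aG g)^T = aG g^-1%g.
Proof.
apply/matrixP => i j; rewrite !mxE !eqxx /=.
rewrite -[i in LHS]gring_valK -[j in RHS]gring_valK !gring_idx_eq.
by rewrite eq_sym (canF_eq (mulgK _)) (eq_sym (enum_val j)) eq_sym.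
Qed.

Lemma regular_trace g : \tr (aG g) = N%:R * (g == 1%g)%:R.
Proof.
have := cfRegE G g; rewrite -cfReprReg cfunE inE mulr1n => ->.
by rewrite mulr_natr.
Qed.

Lemma card_G_neq0 : (N%:R : algC) != 0.
Proof. by rewrite pnatr_eq0 -lt0n cardG_gt0. Qed.

Definition gcoef (y : 'rV[algC]_N) (g : gT) := y 0 (idx g).

(** On row vectors this is right multiplication by the group algebra element with coefficients
    [y]. *)
Definition gsum (y : gT -> algC) : 'M[algC]_N := \sum_g y g *: aG g.

Lemma gring_mx_gsum y : gring_mx aG y = gsum (gcoef y).
Proof.
rewrite /gring_mx /= mulmx_sum_row linear_sum /gsum -sum_enum_val.
by apply: eq_bigr => i _; rewrite linearZ /= rowK mxvecK /gcoef gring_valK.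
Qed.

(** Coefficients are read off by traces, because the regular trace vanishes away from the
    identity. *)
Lemma gsum_trace y g : \tr (gsum y *m aG g^-1%g) = N%:R * y g.
Proof.
rewrite mulmx_suml raddf_sum (bigD1 g) //= big1 ?addr0 => [|h ne_hg].
  rewrite -scalemxAl mxtraceZ -regular_reprM regular_trace mulgV eqxx.
  by rewrite mulr1 mulrC.
rewrite -scalemxAl mxtraceZ -regular_reprM regular_trace -eq_mulgV1.
by rewrite (negPf ne_hg) !mulr0.
Qed.

Lemma gsum_tr y : (gsum y)^T = \sum_g y g *: aG g^-1%g.
Proof.
by rewrite linear_sum; apply: eq_bigr => g _; rewrite linearZ /= regular_trmx.
Qed.

Lemma gring_row_regular g : gring_row (aG g) = delta_mx 0 (idx g).
Proof. by rewrite /gring_row rowK gring_indexK ?inE // mul1g. Qed.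

Lemma gring_row_gsum y :
  gring_row (gsum y) = \sum_g y g *: delta_mx 0 (idx g).
Proof.
rewrite /gsum linear_sum; apply: eq_bigr => g _.
by rewrite linearZ /= gring_row_regular.
Qed.

Lemma gcoef_gring_row y g : gcoef (gring_row (gsum y)) g = y g.
Proof.
rewrite gring_row_gsum /gcoef summxE (bigD1 g) //= big1 => [|h ne_hg].
  by rewrite !mxE !eqxx mulr1 addr0.
by rewrite !mxE gring_idx_eq eq_sym (negPf ne_hg) mulr0.
Qed.

Lemma gring_mx_gring_row y : gring_mx aG (gring_row (gsum y)) = gsum y.
Proof.
by rewrite gring_mx_gsum; apply: eq_bigr => g _; rewrite gcoef_gring_row.
Qed.

(** The map [v |-> y v]. It commutes with the right regular action, and its image is the right ideal
    generated by [y]. *)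
Definition left_mul_mx (y : gT -> algC) : 'M[algC]_N :=
  lin1_mx (mulmx (gring_row (gsum y)) \o gring_mx aG).

Lemma mul_left_mul_mx y v :
  v *m left_mul_mx y = gring_row (gsum y) *m gring_mx aG v.
Proof. by rewrite mul_rV_lin1. Qed.

Lemma left_mul_mx_comm y g : left_mul_mx y *m aG g = aG g *m left_mul_mx y.
Proof.
apply/row_matrixP => i; rewrite !rowE !mulmxA !mul_left_mul_mx.
by rewrite gring_mxJ ?inE // mulmxA.
Qed.

Lemma left_mul_mx_comm_gsum y z :
  left_mul_mx y *m gsum z = gsum z *m left_mul_mx y.
Proof.
rewrite mulmx_suml mulmx_sumr; apply: eq_bigr => g _.
by rewrite -scalemxAl -scalemxAr left_mul_mx_comm.
Qed.

(** The basis element [h] goes to [y h g], whose coefficient at [h] is that of [y] at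
    [h g^-1 h^-1]. *)
Lemma left_mul_mx_trace y g :
  \tr (left_mul_mx y *m aG g) = \sum_h y (h * g^-1 * h^-1)%g.
Proof.
rewrite -sum_enum_val; apply: eq_bigr => i _.
have -> : (left_mul_mx y *m aG g) i i =
    ((delta_mx 0 i : 'rV_N) *m (left_mul_mx y *m aG g)) 0 i.
  by rewrite -(rowE i (left_mul_mx y *m aG g)) [RHS]mxE.
rewrite mulmxA mul_left_mul_mx -mulmxA.
have -> : gring_mx aG (delta_mx 0 i) = aG (enum_val i).
  by rewrite /gring_mx /= -rowE rowK mxvecK.
rewrite -regular_reprM gring_row_gsum mulmx_suml summxE.
have coef h : ((y h *: (delta_mx 0 (idx h) : 'rV_N)) *m aG (enum_val i * g)%g) 0 i
    = y h * (i == idx (h * (enum_val i * g))%g)%:R.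
  rewrite -scalemxAl -gring_row_regular -gring_row_mul -regular_reprM.
  by rewrite gring_row_regular !mxE eqxx.
rewrite (bigD1 (enum_val i * g^-1 * (enum_val i)^-1)%g) //= big1.
  by rewrite coef mulgA mulgKV mulgKV gring_valK eqxx mulr1 addr0.
move=> h ne_h; rewrite coef -[i in i == _]gring_valK gring_idx_eq.
case: eqP => [e|_]; last by rewrite mulr0.
by case/eqP: ne_h; rewrite {1}e !mulgA !mulgK.
Qed.

(** Rewrites the trace of [x |-> y x z] in terms of the products [y h z], which the sandwich
    identity evaluates for Young symmetrizers. *)
Lemma left_mul_mx_gsum_trace y z :
  \tr (left_mul_mx y *m gsum z) =
    N%:R^-1 * \sum_h \tr (gsum y *m aG h *m gsum z *m aG h^-1%g).
Proof.
rewrite [in LHS]/gsum mulmx_sumr raddf_sum /=.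
under eq_bigr => g _ do rewrite -scalemxAr mxtraceZ left_mul_mx_trace.
under [in RHS]eq_bigr => h _.
  rewrite {2}/gsum mulmx_sumr mulmx_suml raddf_sum /=.
  under eq_bigr => g _.
    rewrite -scalemxAr -scalemxAl mxtraceZ -!mulmxA -!regular_reprM.
    have ->: (h * (g * h^-1) = (h * g^-1 * h^-1)^-1)%g.
      by rewrite !invMg !invgK !mulgA.
    rewrite gsum_trace; over.
  over.
rewrite exchange_big mulr_sumr /=; apply: eq_bigr => g _.
rewrite !mulr_sumr; apply: eq_bigr => h _.
by rewrite [RHS]mulrCA mulKf ?card_G_neq0.
Qed.

Section QuasiIdempotent.

Variables (y : gT -> algC) (m : algC).
Hypotheses (m0 : m != 0) (yy : gsum y *m gsum y = m *: gsum y).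

Definition ideal_char : 'CF([set: gT]) :=
  cfRepr (submod_repr (cyclic_mx_module aG (gring_row (gsum y)))).

Lemma left_mul_mx_quasi_idem :
  left_mul_mx y *m left_mul_mx y = m *: left_mul_mx y.
Proof.
apply/row_matrixP => i; rewrite [RHS]linearZ /= !rowE mulmxA !mul_left_mul_mx.
by rewrite gring_mxA gring_mx_gring_row mulmxA -gring_row_mul yy linearZ
           -scalemxAl.
Qed.

Lemma left_mul_mx_cyclic :
  (left_mul_mx y :=: cyclic_mx aG (gring_row (gsum y)))%MS.
Proof.
apply/eqmxP/andP; split; apply/row_subP => i.
  apply/cyclic_mxP; exists (gring_mx aG (delta_mx 0 i)).
    exact: gring_mxP.
  by rewrite rowE mul_left_mul_mx.
have [A EA ->] := cyclic_mxP (row_sub i (cyclic_mx aG (gring_row (gsum y)))).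
by rewrite -(gring_rowK EA) -mul_left_mul_mx submxMl.
Qed.

Lemma ideal_charE g : ideal_char g = m^-1 * \sum_h y (h * g^-1 * h^-1)%g.
Proof.
rewrite cfunE inE mulr1n (trace_submod _ m0 left_mul_mx_quasi_idem).
- by rewrite left_mul_mx_trace.
- exact: left_mul_mx_cyclic.
exact: left_mul_mx_comm.
Qed.

Lemma ideal_char_is_char : ideal_char \is a character.
Proof. exact: cfRepr_char. Qed.

Lemma ideal_char1 : ideal_char 1%g = m^-1 * (N%:R * y 1%g).
Proof.
rewrite ideal_charE; under eq_bigr => h _ do rewrite invg1 mulg1 mulgV.
by rewrite mulr_natl -sumr_const; congr (_ * _); apply: eq_bigl => h; rewrite inE.
Qed.

(* A class function averages out the conjugations in the trace formula. *)
Lemma sum_ideal_char (F : gT -> algC) :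
    (forall g h, F (g ^ h)%g = F g) ->
  \sum_g ideal_char g * F g = m^-1 * (N%:R * \sum_g y g * F g^-1%g).
Proof.
move=> Fclass; under eq_bigr => g _ do rewrite ideal_charE -mulrA mulr_suml.
rewrite -mulr_sumr exchange_big /=; congr (_ * _).
rewrite mulr_natl -sumr_const.
apply: eq_big => [h | h _]; first by rewrite inE.
rewrite (reindex_inj (h := fun g => (g^-1 ^ h)%g)) /=; last first.
  by move=> g1 g2 /conjg_inj/invg_inj.
apply: eq_bigr => g _; rewrite Fclass; congr (y _ * _).
by rewrite conjVg invgK conjgE !mulgA mulgV mul1g mulgK.
Qed.

Lemma cfdot_ideal_char (phi : 'CF([set: gT])) :
  '[phi, ideal_char] = m^-1 * \sum_g y g * phi g.
Proof.
rewrite cfdotE.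
under eq_bigr => g _ do
  rewrite -char_inv ?ideal_char_is_char // mulrC.
rewrite (eq_bigl predT) => [|g]; last by rewrite inE.
rewrite (reindex_inj invg_inj) /=.
under eq_bigr => g _ do rewrite invgK.
rewrite (sum_ideal_char (F := fun g => phi g^-1%g)); last first.
  by move=> g h; rewrite -conjVg cfunJ ?inE.
rewrite mulrCA mulKf ?card_G_neq0 //.
by congr (_ * _); apply: eq_bigr => g _; rewrite invgK.
Qed.

End QuasiIdempotent.

Lemma cfdot_ideal_char2 y m z p (m0 : m != 0) (p0 : p != 0)
    (yy : gsum y *m gsum y = m *: gsum y) (zz : gsum z *m gsum z = p *: gsum z) :
  '[ideal_char y, ideal_char z] =
    m^-1 * p^-1 * \tr (left_mul_mx y *m gsum z).
Proof.
rewrite (cfdot_ideal_char p0 zz) [m^-1 * _]mulrC -mulrA; congr (_ * _).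
rewrite /gsum mulmx_sumr linear_sum mulr_sumr; apply: eq_bigr => g _.
rewrite (ideal_charE m0 yy) -left_mul_mx_trace -scalemxAr linearZ /=.
by rewrite mulrCA.
Qed.

Lemma left_mul_mx_gsum_quasi_idem y m z p
    (yy : gsum y *m gsum y = m *: gsum y) (zz : gsum z *m gsum z = p *: gsum z) :
  let P := left_mul_mx y *m gsum z in P *m P = (m * p) *: P.
Proof.
rewrite /= {1}left_mul_mx_comm_gsum -mulmxA [_ *m (_ *m gsum z)]mulmxA.
rewrite (left_mul_mx_quasi_idem yy) -scalemxAl -scalemxAr mulmxA.
by rewrite -left_mul_mx_comm_gsum -mulmxA zz -scalemxAr scalerA.
Qed.

(* The trace of a quasi-idempotent is proportional to its rank. *)
Lemma trace_neq0_of_prod y m z p g (m0 : m != 0) (p0 : p != 0)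
    (yy : gsum y *m gsum y = m *: gsum y) (zz : gsum z *m gsum z = p *: gsum z) :
  gsum y *m aG g *m gsum z != 0 -> \tr (left_mul_mx y *m gsum z) != 0.
Proof.
apply: contraNneq => tr0.
have /eqP := mxtrace_quasi_idem (left_mul_mx_gsum_quasi_idem yy zz).
rewrite tr0 eq_sym mulf_eq0 (negPf (mulf_neq0 m0 p0)) /= pnatr_eq0 mxrank_eq0.
move/eqP => P0.
(* The vanishing operator [x |-> y x z], evaluated at [x = g], gives the row form of the product
   [y g z]. *)
have := congr1 (mulmx (gring_row (aG g))) P0.
rewrite mulmx0 mulmxA mul_left_mul_mx.
have -> : gring_mx aG (gring_row (aG g)) = aG g.
  by rewrite -[LHS]/(gring_op aG (aG g)) gring_opG ?inE.
move=> e; rewrite -mulmxA -gring_row_mul in e.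
have def_prod : gsum y *m aG g *m gsum z =
    gring_mx aG (gring_row (gsum y *m (aG g *m gsum z))).
  have memz : (aG g *m gsum z \in group_ring algC [set: gT])%MS.
    rewrite /gsum mulmx_sumr linear_sum summx_sub // => h _.
    by rewrite -scalemxAr linearZ scalemx_sub // -regular_reprM
               envelop_mx_id ?inE.
  rewrite gring_row_mul -[aG g *m gsum z in RHS](gring_rowK memz).
  by rewrite gring_mxA gring_mx_gring_row (gring_rowK memz) mulmxA.
by apply/eqP; apply: (etrans def_prod); rewrite e linear0.
Qed.

End GroupAlgebra.

(** * Young symmetrizers *)

Lemma card_le_of_inj (T : finType) (S : {set T}) (f : T -> nat) m :
  {in S &, injective f} -> (forall i, i \in S -> (f i < m)%N) -> (#|S| <= m)%N.
Proof.
move=> injf ltf; rewrite cardE -(size_map f) -[leqRHS](size_iota 0).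
apply: uniq_leq_size => [|x /mapP[i]]; last first.
  by rewrite mem_enum mem_iota => /ltf ? ->.
rewrite map_inj_in_uniq ?enum_uniq // => i j.
by rewrite !mem_enum; apply: injf.
Qed.

Lemma le_card_of_surj (T : finType) (S : {set T}) (f : T -> nat) m :
  (forall r, (r < m)%N -> exists2 i, i \in S & f i = r) -> (m <= #|S|)%N.
Proof.
move=> surj; rewrite cardE -(size_map f) -[leqLHS](size_iota 0).
apply: uniq_leq_size (iota_uniq _ _) _ => r; rewrite mem_iota => /surj[i iS <-].
by apply: map_f; rewrite mem_enum.
Qed.

(** * Cells of a diagram, with their rows and columns *)

Section Cells.

Variables (k : nat) (a : intpartn k).

Definition cell_row (i : 'I_k) := reshape_index a i.
Definition cell_col (i : 'I_k) := reshape_offset a i.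

Lemma sumn_part : sumn a = k.
Proof. by have /andP[_ /eqP] := valP a. Qed.

Lemma part_sorted : sorted geq (parts a).
Proof. by have /andP[/andP[]] := valP a. Qed.

Lemma part_notin0 : 0%N \notin parts a.
Proof. by have /andP[/andP[]] := valP a. Qed.

Lemma nth_part_le i j : (i <= j)%N -> (nth 0 a j <= nth 0 a i)%N.
Proof.
move=> le_ij; have [lt_j|le_j] := ltnP j (size a); last first.
  by rewrite [nth _ _ j]nth_default.
have tr : transitive geq by move=> x y z; rewrite /geq /= => H1 H2; lia.
have rf : reflexive geq by move=> x; apply: leqnn.
by apply: (sorted_leq_nth tr rf 0%N part_sorted); rewrite ?inE ?(leq_ltn_trans le_ij).
Qed.

Lemma nth_part_notin0 i : (0 < nth 0 a i)%N = (i < size a)%N.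
Proof.
have [lt_i|le_i] := ltnP i (size a); last by rewrite nth_default.
rewrite lt0n; apply: contra part_notin0 => /eqP <-; exact: mem_nth.
Qed.

Lemma cell_col_lt i : (cell_col i < nth 0 a (cell_row i))%N.
Proof. by apply: reshape_offsetP; rewrite sumn_part. Qed.

Lemma cell_inj i j : cell_row i = cell_row j -> cell_col i = cell_col j -> i = j.
Proof.
rewrite /cell_row /cell_col => eq_r eq_c; apply: val_inj => /=.
by rewrite -[LHS](reshape_indexK a) -[RHS](reshape_indexK a) eq_r eq_c.
Qed.

Lemma cell_exists r c :
  (c < nth 0 a r)%N -> exists i, cell_row i = r /\ cell_col i = c.
Proof.
move=> lt_c; have := flatten_indexP lt_c; rewrite sumn_part => lt_k.
exists (Ordinal lt_k).
by rewrite /cell_row /cell_col /= flatten_indexKl ?flatten_indexKr.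
Qed.

Lemma cell_col_ltk i : (cell_col i < k)%N.
Proof. by rewrite (leq_ltn_trans (leq_subr _ _)). Qed.

Lemma mem_row_stab (s : 'S_k) :
  reflect (forall i, cell_row (s i) = cell_row i) (s \in row_stab a).
Proof. by rewrite inE; apply: (iffP forallP) => H i; apply/eqP/H. Qed.

Lemma mem_col_stab (s : 'S_k) :
  reflect (forall i, cell_col (s i) = cell_col i) (s \in col_stab a).
Proof. by rewrite inE; apply: (iffP forallP) => H i; apply/eqP/H. Qed.

Lemma row_stab_group : group_set (row_stab a).
Proof.
apply/group_setP; split=> [|s t /mem_row_stab Hs /mem_row_stab Ht].
  by apply/mem_row_stab => i; rewrite perm1.
by apply/mem_row_stab => i; rewrite permM Ht.
Qed.

Lemma col_stab_group : group_set (col_stab a).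
Proof.
apply/group_setP; split=> [|s t /mem_col_stab Hs /mem_col_stab Ht].
  by apply/mem_col_stab => i; rewrite perm1.
by apply/mem_col_stab => i; rewrite permM Ht.
Qed.

Lemma row_col_stab1 s : s \in row_stab a -> s \in col_stab a -> s = 1%g.
Proof.
move=> /mem_row_stab Hr /mem_col_stab Hc.
by apply/permP => i; rewrite perm1; apply: cell_inj.
Qed.

(* Either the first m rows contain the whole column c, or they meet it m times. *)
Lemma card_col_rows c m n :
    (n <= m)%N -> (n <= #|[set i | cell_col i == c]|)%N ->
  (n <= #|[set i | (cell_row i < m)%N && (cell_col i == c)]|)%N.
Proof.
move=> le_nm le_n; set S := [set i | _ && _].
have [/existsP[i0 /andP[/eqP col_i0 le_m]] | ] :=
  boolP [exists i, (cell_col i == c) && (m <= cell_row i)%N].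
  apply: leq_trans le_nm _.
  apply: (@le_card_of_surj _ _ cell_row) => r lt_rm.
  have lt_c : (c < nth 0 a r)%N.
    rewrite -col_i0 (leq_trans (cell_col_lt i0)) // nth_part_le //.
    exact: ltnW (leq_trans lt_rm le_m).
  have [i [ri ci]] := cell_exists lt_c.
  by exists i; rewrite // inE ri ci lt_rm eqxx.
rewrite negb_exists => /forallP no; apply: leq_trans le_n _.
apply: subset_leq_card; apply/subsetP => i; rewrite !inE => ci.
by have := no i; rewrite ci /= -ltnNge => ->.
Qed.

End Cells.

(** The classical dichotomy. If it fails, a transposition of the row group of [a] becomes, through
    [g], a transposition of the column group of [b], and [A g B] vanishes; if it holds, [a] is below
    [b] in the dominance order. *)
Definition separates k (a b : intpartn k) (g : 'S_k) :=
  [forall i, forall j, (i != j) && (cell_row a i == cell_row a j) ==>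
     (cell_col b (g i) != cell_col b (g j))].

Section Separates.

Variables (k : nat) (a b : intpartn k) (g : 'S_k).
Hypothesis sep : separates a b g.

Lemma separatesP i j : cell_row a i = cell_row a j ->
  cell_col b (g i) = cell_col b (g j) -> i = j.
Proof.
move=> eq_r eq_c; have /forallP/(_ i)/forallP/(_ j) := sep.
by rewrite eq_r eq_c !eqxx andbT; case: eqP.
Qed.

(** Cells of [a] sent to column [c] lie in distinct rows, so at most [m] of them are in the first
    [m] rows; there are also at most as many as cells in column [c] of [b]. The right-hand side is
    the smaller of these two bounds. *)
Lemma card_separates_col c m :
  (#|[set i | (cell_row a i < m)%N && (cell_col b (g i) == c)]| <=
   #|[set i | (cell_row b i < m)%N && (cell_col b i == c)]|)%N.
Proof.
apply: card_col_rows.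
  apply: (@card_le_of_inj _ _ (cell_row a)) => [i j|i].
    rewrite !inE => /andP[_ /eqP ci] /andP[_ /eqP cj] eq_r.
    by apply: separatesP; rewrite // ci cj.
  by rewrite inE => /andP[].
rewrite -(card_imset _ (@perm_inj _ g)); apply: subset_leq_card.
by apply/subsetP => _ /imsetP[i iS ->]; move: iS; rewrite !inE => /andP[].
Qed.


Lemma card_split_col (P : pred 'I_k) (h : 'I_k -> 'I_k) :
  #|[set i | P i]| =
  (\sum_(c < k) #|[set i | P i && (cell_col b (h i) == c)]|)%N.
Proof.
rewrite -sum1_card (partition_big (fun i => Ordinal (cell_col_ltk b (h i))) predT) //=.
apply: eq_bigr => c _; rewrite -sum1_card; apply: eq_bigl => i.
by rewrite !inE -val_eqE.
Qed.

(** Dominance of [a] by [b], summed column by column. *)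
Lemma card_separates_rows m :
  (#|[set i | (cell_row a i < m)%N]| <= #|[set i | (cell_row b i < m)%N]|)%N.
Proof.
rewrite (card_split_col _ g) [leqRHS](card_split_col _ id).
by apply: leq_sum => c _; apply: card_separates_col.
Qed.

End Separates.

Lemma nth_part_card k (a : intpartn k) m :
  nth 0%N a m = #|[set i | cell_row a i == m]|.
Proof.
apply/eqP; rewrite eqn_leq; apply/andP; split.
  apply: (@le_card_of_surj _ _ (cell_col a)) => c /cell_exists[i [ri ci]].
  by exists i; rewrite // inE ri.
apply: (@card_le_of_inj _ _ (cell_col a)) => [i j|i]; rewrite !inE.
  by move=> /eqP ri /eqP rj; apply: cell_inj; rewrite ri rj.
by move=> /eqP <-; apply: cell_col_lt.
Qed.

Lemma part_eq_nth k (a b : intpartn k) :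
  (forall m, nth 0%N a m = nth 0%N b m) -> a = b.
Proof.
move=> eq_ab; apply: val_inj; apply: (@eq_from_nth _ 0%N) => [|i _ //].
have eq_sz i : (i < size a)%N = (i < size b)%N by rewrite -!nth_part_notin0 eq_ab.
have ba := eq_sz (size b); have ab := eq_sz (size a).
by case: (ltngtP (size a) (size b)) ab ba; rewrite ?ltnn.
Qed.

(* Two shapes separated in both directions dominate each other. *)
Lemma separates_eq k (a b : intpartn k) g h :
  separates a b g -> separates b a h -> a = b.
Proof.
move=> sep_ab sep_ba; apply: part_eq_nth => m; rewrite !nth_part_card.
have eq_lt n :
    #|[set i | (cell_row a i < n)%N]| = #|[set i | (cell_row b i < n)%N]|.
  by apply/eqP; rewrite eqn_leq (card_separates_rows sep_ab)
                        (card_separates_rows sep_ba).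
have split_lt (c : intpartn k) : #|[set i | cell_row c i == m]| =
    (#|[set i | (cell_row c i < m.+1)%N]| - #|[set i | (cell_row c i < m)%N]|)%N.
  rewrite -[#|[set i | (_ < m.+1)%N]|](cardsID [set i | cell_row c i == m]).
  have -> : [set i | (cell_row c i < m.+1)%N] :&: [set i | cell_row c i == m]
      = [set i | cell_row c i == m].
    by apply/setP => i; rewrite !inE; lia.
  have -> : [set i | (cell_row c i < m.+1)%N] :\: [set i | cell_row c i == m]
      = [set i | (cell_row c i < m)%N].
    by apply/setP => i; rewrite !inE; lia.
  by rewrite addnK.
by rewrite !split_lt !eq_lt.
Qed.

(** The equality case of dominance. Each cell [i] can be moved within its own row to the column of
    [g i]; these moves form [p], and what remains of [g] preserves columns. *)
Lemma separates_factor k (a : intpartn k) g :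
  separates a a g ->
  exists p q, [/\ p \in row_stab a, q \in col_stab a & g = (p * q)%g].
Proof.
move=> sep.
have eq_col c m : (c < k)%N ->
    #|[set i | (cell_row a i < m)%N && (cell_col a (g i) == c)]| =
    #|[set i | (cell_row a i < m)%N && (cell_col a i == c)]|.
  move=> lt_c.
  have := card_split_col a (fun i => (cell_row a i < m)%N) g.
  rewrite (card_split_col a _ id) => /esym/eqP.
  (* Termwise inequalities with equal totals are termwise equalities. *)
  have := fun c' : 'I_k => leqif_eq (card_separates_col sep c' m).
  move=> H; have := leqif_sum (P := predT) (fun c' _ => H c').
  by move=> [_ eq_sums]; rewrite eq_sums => /forallP/(_ (Ordinal lt_c))/eqP.
have ex_cell i : exists j, (cell_row a j == cell_row a i) &&
    (cell_col a j == cell_col a (g i)).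
  suff /cell_exists[j [rj cj]] : (cell_col a (g i) < nth 0 a (cell_row a i))%N.
    by exists j; rewrite rj cj !eqxx.
  (* Otherwise column [c] lies entirely above the row of [i]. By [eq_col] all preimages of column
     [c] then lie above that row, yet [i] is one of them. *)
  rewrite ltnNge; apply/negP => no_cell.
  set c := cell_col a (g i) in no_cell *.
  have all_lt j : cell_col a j == c -> (cell_row a j < cell_row a i)%N.
    move=> /eqP cj; rewrite ltnNge; apply/negP => /nth_part_le le.
    have := leq_trans (cell_col_lt a j) (leq_trans (le _ a) no_cell).
    by rewrite cj ltnn.
  have lt_c : (c < k)%N by apply: cell_col_ltk.
  have := eq_col c (cell_row a i) lt_c.
  have -> : [set j | (cell_row a j < cell_row a i)%N & cell_col a j == c]
      = [set j | cell_col a j == c].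
    by apply/setP => j; rewrite !inE andbC; case: eqP => //= /eqP/all_lt ->.
  rewrite -[in RHS](card_preimset _ (@perm_inj _ g)) => /eqP.
  have sub : [set j | (cell_row a j < cell_row a i)%N & cell_col a (g j) == c]
      \subset g @^-1: [set j | cell_col a j == c].
    by apply/subsetP => j; rewrite !inE => /andP[].
  rewrite (subset_leqif_card sub) => eq_card.
  have : i \in g @^-1: [set j | cell_col a j == c] by rewrite !inE eqxx.
  by move/(subsetP eq_card); rewrite inE ltnn.
pose f i := xchoose (ex_cell i).
have f_row i : cell_row a (f i) = cell_row a i by have /andP[/eqP] := xchooseP (ex_cell i).
have f_col i : cell_col a (f i) = cell_col a (g i) 
  by have /andP[_ /eqP] := xchooseP (ex_cell i).
have injf : injective f.
  move=> i j eq_f; apply: (separatesP sep).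
    by rewrite -f_row eq_f f_row.
  by rewrite -f_col eq_f f_col.
exists (perm injf), ((perm injf)^-1 * g)%g; split; last by rewrite mulKVg.
  by apply/mem_row_stab => i; rewrite permE.
apply/mem_col_stab => x; rewrite -[x in LHS](permKV (perm injf)) permM permK.
by rewrite -f_col -(permE injf) permKV.
Qed.

Section Symmetrizer.

Variables (k : nat) (a : intpartn k).

Definition young_coef (g : 'S_k) : algC :=
  \sum_(p in row_stab a) \sum_(q in col_stab a)
     (-1) ^+ odd_perm q * ((p * q)%g == g)%:R.

(** The factorization [p * q] is unique because the two stabilizers meet trivially, so a single term
    of the double sum survives. *)
Lemma young_coefM p q : p \in row_stab a -> q \in col_stab a ->
  young_coef (p * q) = (-1) ^+ odd_perm q.
Proof.
pose R := group (row_stab_group a); pose C := group (col_stab_group a).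
move=> Rp Cq; rewrite /young_coef (bigD1 p) //= (bigD1 q) //= eqxx mulr1.
rewrite big1 ?addr0 => [|q' /andP[_ ne_q]]; last first.
  by rewrite (inj_eq (mulgI p)) (negPf ne_q) mulr0.
rewrite big1 ?addr0 // => p' /andP[Rp' ne_p]; rewrite big1 // => q' Cq'.
case: eqP => [e|_]; last by rewrite mulr0.
case/eqP: ne_p; apply/eqP; rewrite eq_mulgV1; apply/eqP.
have e' : (p^-1 * p' = q * q'^-1)%g.
  by apply: (mulgI p); rewrite mulKVg mulgA -e mulgK.
apply/eqP; rewrite -eq_mulgV1 eq_sym eq_mulVg1; apply/eqP.
apply: (@row_col_stab1 _ a).
  by apply: (groupM (G := R)); rewrite ?groupV.
by rewrite e'; apply: (groupM (G := C)); rewrite ?(groupV C).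
Qed.

Lemma young_coef0 g : ~~ separates a a g -> young_coef g = 0.
Proof.
move=> nsep; rewrite /young_coef big1 // => p Rp; rewrite big1 // => q Cq.
case: eqP => [e|_]; last by rewrite mulr0.
case/negP: nsep; apply/forallP => i; apply/forallP => j.
apply/implyP => /andP[ne_ij /eqP eq_r]; apply: contra ne_ij => /eqP eq_c.
apply/eqP/(@perm_inj _ p); apply: (@cell_inj _ a).
  by move/mem_row_stab: Rp => Rp; rewrite !Rp.
move: eq_c; rewrite -e !permM.
by move/mem_col_stab: Cq => Cq; rewrite !Cq.
Qed.

Lemma young_coef1 : young_coef 1 = 1.
Proof.
have := young_coefM (group1 (group (row_stab_group a)))
                    (group1 (group (col_stab_group a))).
by rewrite mulg1 odd_perm1.
Qed.

Lemma young_coef_real g : young_coef g \is Num.real.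
Proof.
rewrite /young_coef rpred_sum // => p _; rewrite rpred_sum // => q _.
by rewrite rpredM ?rpredX ?rpredN ?rpred1 ?realn.
Qed.

End Symmetrizer.

(** * Row and column sums in an arbitrary representation *)

Section Sums.

Variables (k n : nat) (rho : 'S_k -> 'M[algC]_n).
Hypothesis rhoM : forall g h, rho (g * h)%g = rho g *m rho h.
Implicit Types a b : intpartn k.

(** [rho] is kept abstract because the identities are used both in the regular representation of S_k
    and, along [raise], in that of S_(k+1). *)
Definition row_sum a := \sum_(p in row_stab a) rho p.
Definition col_sum a := \sum_(q in col_stab a) (-1) ^+ odd_perm q *: rho q.

Lemma row_sum_mul a p : p \in row_stab a -> row_sum a *m rho p = row_sum a.
Proof.
move=> Rp; rewrite /row_sum mulmx_suml.
under eq_bigr => q _ do rewrite -rhoM.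
rewrite [RHS](reindex_inj (mulIg p)) /=; apply: eq_bigl => q.
by rewrite (groupMr _ (Rp : p \in group (row_stab_group a))).
Qed.

Lemma mul_col_sum a q : q \in col_stab a ->
  rho q *m col_sum a = (-1) ^+ odd_perm q *: col_sum a.
Proof.
move=> Cq; rewrite /col_sum mulmx_sumr scaler_sumr.
rewrite [RHS](reindex_inj (mulgI q)) /=; apply: eq_big => [h|h _].
  by rewrite (groupMl _ (Cq : q \in group (col_stab_group a))).
rewrite -scalemxAr -rhoM scalerA odd_permM signr_addb mulrA.
by rewrite -signr_addb addbb mul1r.
Qed.

(** If [i] and [j] share a row and [g i], [g j] a column, then [t = tperm i j] satisfies
    [t g = g t'] with [t'] a column transposition. Hence A g B = A t g B = A g t' B = - A g B. *)
Lemma row_col_sum0 a b g :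
  ~~ separates a b g -> row_sum a *m rho g *m col_sum b = 0.
Proof.
rewrite negb_forall => /existsP[i]; rewrite negb_forall => /existsP[j].
rewrite negb_imply negbK => /andP[/andP[ne_ij /eqP eq_r] /eqP eq_c].
have Rt : tperm i j \in row_stab a.
  by apply/mem_row_stab => x; case: tpermP => [->|->|].
have Ct : tperm (g i) (g j) \in col_stab b.
  by apply/mem_col_stab => x; case: tpermP => [->|->|].
have := congr1 (fun M => M *m rho g *m col_sum b) (row_sum_mul Rt).
have tg : (tperm i j * g = g * tperm (g i) (g j))%g.
  by rewrite -tpermJ conjgC.
rewrite -[row_sum a *m _ *m rho g]mulmxA -rhoM tg rhoM mulmxA -mulmxA.
rewrite mul_col_sum // odd_tperm (inj_eq perm_inj) ne_ij expr1 scaleN1r mulmxN.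
move=> /eqP; rewrite eq_sym -addr_eq0 -mulr2n -scaler_nat scaler_eq0.
by rewrite pnatr_eq0 => /eqP.
Qed.

(** Only the inner factors are expanded, so that each term has the sandwich form [A x B]. *)
Lemma row_col_mid a b g :
  row_sum a *m col_sum a *m rho g *m (row_sum b *m col_sum b) =
  \sum_(q in col_stab a) \sum_(p in row_stab b)
    (-1) ^+ odd_perm q *: (row_sum a *m rho (q * (g * p))%g *m col_sum b).
Proof.
have BA : col_sum a *m (rho g *m row_sum b) =
    \sum_(q in col_stab a) \sum_(p in row_stab b)
      (-1) ^+ odd_perm q *: rho (q * (g * p))%g.
  rewrite mulmx_suml; apply: eq_bigr => q _; rewrite !mulmx_sumr.
  by apply: eq_bigr => p _; rewrite -scalemxAl !rhoM.
move: (row_sum a) (col_sum a) (row_sum b) (col_sum b) BA => A B A' B' BA.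
have -> : A *m B *m rho g *m (A' *m B') = A *m (B *m (rho g *m A')) *m B'.
  by rewrite !mulmxA.
rewrite BA mulmx_sumr mulmx_suml; apply: eq_bigr => q _.
rewrite mulmx_sumr mulmx_suml; apply: eq_bigr => p _.
by rewrite -scalemxAr -scalemxAl.
Qed.

(** Either [g = p * q], with [p] absorbed by the row sum and [q] by the column sum up to its sign,
    or both sides vanish. *)
Lemma young_sandwich a g : row_sum a *m rho g *m col_sum a =
  young_coef a g *: (row_sum a *m col_sum a).
Proof.
have [sep|nsep] := boolP (separates a a g); last first.
  by rewrite young_coef0 // scale0r row_col_sum0.
have [p [q [Rp Cq ->]]] := separates_factor sep.
rewrite young_coefM // rhoM mulmxA row_sum_mul // -mulmxA mul_col_sum //.
by rewrite -scalemxAr.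
Qed.

Lemma row_col_sum a :
  row_sum a *m col_sum a = \sum_g young_coef a g *: rho g.
Proof.
rewrite /row_sum /col_sum mulmx_suml.
rewrite [RHS](eq_bigr (fun g => \sum_(p in row_stab a) \sum_(q in col_stab a)
  ((-1) ^+ odd_perm q * ((p * q)%g == g)%:R) *: rho g)); last first.
  by move=> g _; rewrite scaler_suml; apply: eq_bigr => p _; rewrite scaler_suml.
rewrite exchange_big; apply: eq_bigr => p _ /=.
rewrite exchange_big mulmx_sumr; apply: eq_bigr => q _ /=.
rewrite (bigD1 (p * q)%g) //= eqxx mulr1 big1 ?addr0 => [|g ne_g].
  by rewrite rhoM scalemxAr.
by rewrite eq_sym (negPf ne_g) mulr0 scale0r.
Qed.

(** The scalar by which the symmetrizer multiplies itself; by [ideal_char1] and [young_coef1] it is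
    k! divided by the dimension of the Specht module. *)
Definition young_norm a : algC :=
  \sum_(q in col_stab a) \sum_(p in row_stab a)
    (-1) ^+ odd_perm q * young_coef a (q * p).

Hypothesis rho1 : rho 1%g = 1%:M.

Lemma young_symmetrizer_sqr a :
  let c := row_sum a *m col_sum a in c *m c = young_norm a *: c.
Proof.
have /= := row_col_mid a a 1; rewrite rho1 mulmx1 => ->.
rewrite scaler_suml; apply: eq_bigr => q _; rewrite scaler_suml.
by apply: eq_bigr => p _; rewrite mul1g young_sandwich scalerA.
Qed.

End Sums.

(** * Irreducibility and the Frobenius-Schur sum *)

Section SpechtCharacter.

Variables (k : nat) (a : intpartn k).
Local Notation aG := (regular_repr algC [set: 'S_k]).
Local Notation N := (#|[set: 'S_k]|%:R : algC).
Local Notation c := (young_coef a).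
Local Notation m := (young_norm a).
Local Notation C := (gsum (young_coef a)).

Lemma young_gsum : C = row_sum aG a *m col_sum aG a.
Proof. by rewrite (row_col_sum (@regular_reprM _)). Qed.

Lemma young_gsum_sqr : C *m C = m *: C.
Proof.
rewrite young_gsum (young_symmetrizer_sqr (@regular_reprM _)) //.
exact: repr_mx1.
Qed.

Lemma mxtrace_young : \tr C = N.
Proof.
have := gsum_trace c 1%g; rewrite invg1 (repr_mx1 aG) mulmx1 => ->.
by rewrite young_coef1 mulr1.
Qed.

(** A zero norm would force trace 0, but the trace is the group order since the identity has
    coefficient 1. *)
Lemma young_norm_neq0 : m != 0.
Proof.
apply/eqP => m0; have := mxtrace_quasi_idem young_gsum_sqr.
by rewrite mxtrace_young m0 mul0r => /eqP; rewrite (negPf (card_G_neq0 _)).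
Qed.

Lemma specht_char_ideal : specht_char a = ideal_char c.
Proof.
rewrite /specht_char /specht_repr /ideal_char.
suff -> : young_symmetrizer a = gring_row C by [].
rewrite young_gsum mulmx_suml linear_sum; apply: eq_bigr => p _ /=.
rewrite mulmx_sumr linear_sum; apply: eq_bigr => q _ /=.
by rewrite -scalemxAr -regular_reprM linearZ /= gring_row_regular.
Qed.

(** The sandwich identity shows that [C g C] is a multiple of [C]; comparing traces, with tr (C g C)
    = m tr (C g), identifies the scalar. *)
Lemma young_mid g : C *m aG g *m C = (m * c g^-1%g) *: C.
Proof.
have [l Dl] : exists l, C *m aG g *m C = l *: C.
  exists (\sum_(q in col_stab a) \sum_(p in row_stab a)
    (-1) ^+ odd_perm q * c (q * (g * p))%g).
  have regM := @regular_reprM 'S_k.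
  rewrite young_gsum (row_col_mid regM) scaler_suml; apply: eq_bigr => q _.
  rewrite scaler_suml; apply: eq_bigr => p _.
  by rewrite (young_sandwich regM) scalerA.
rewrite Dl; congr (_ *: _).
have := congr1 mxtrace Dl.
rewrite mxtraceZ mxtrace_young -mulmxA mxtrace_mulC -mulmxA young_gsum_sqr.
rewrite -scalemxAr mxtraceZ mxtrace_mulC -[g in aG g]invgK gsum_trace.
by rewrite mulrCA mulrC => /(mulIf (card_G_neq0 _)).
Qed.

Lemma specht_char_is_char : specht_char a \is a character.
Proof. exact: cfRepr_char. Qed.

(** The norm is the normalized sum of the tr (C h C h^-1). By [young_mid] this sum is [m] times tr
    (C C), that is [m * m * N], and the normalization brings it to 1. *)
Lemma specht_char_irr : specht_char a \in irr [set: 'S_k].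
Proof.
rewrite irrEchar specht_char_is_char specht_char_ideal /=; apply/eqP.
rewrite (cfdot_ideal_char2 young_norm_neq0 young_norm_neq0) ?young_gsum_sqr //.
rewrite left_mul_mx_gsum_trace.
under eq_bigr => h _ do rewrite young_mid -scalemxAl mxtraceZ gsum_trace.
have -> : \sum_h m * c h^-1%g * (N * c h) = m * \tr (C *m C).
  rewrite [X in C *m X]/gsum mulmx_sumr raddf_sum mulr_sumr.
  apply: eq_bigr => h _; rewrite -scalemxAr /= mxtraceZ.
  rewrite -[h in aG h]invgK gsum_trace.
  by rewrite -mulrA; congr (_ * _); rewrite mulrCA mulrA mulrC.
rewrite young_gsum_sqr mxtraceZ mxtrace_young.
have := young_norm_neq0; have := card_G_neq0 'S_k.
by move: N m => x y x0 y0; field; rewrite x0 y0.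
Qed.

Lemma young_sum_squares : \sum_g c g * c g != 0.
Proof.
rewrite (bigD1 1%g) //= young_coef1 mulr1 gt_eqF // ltr_pwDl ?ltr01 //.
by apply: sumr_ge0 => g _; rewrite -expr2 real_exprn_even_ge0 ?young_coef_real.
Qed.

(* [T = sum_u u^2] is central, so [T C = th C]; since also
   [T C = sum_u u C^T u], multiplying by [C^T] and taking traces gives
   [th = m], because [C^T u C^T = m c(u) C^T]. *)
Lemma sum_young_coef_sqr : \sum_u c (u * u)%g = m.
Proof.
set th := \sum_u _.
pose T : 'M_(gcard [set: 'S_k]) := \sum_u aG (u * u)%g.
have regM := @regular_reprM 'S_k.
have T_central g : T *m aG g = aG g *m T.
  rewrite mulmx_suml mulmx_sumr (reindex_inj (conjg_inj g^-1%g)) /=.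
  apply: eq_bigr => u _; rewrite -!regM; congr (aG _).
  by rewrite !conjgE !invgK !mulgA !mulgKV.
have T_C : T *m C = C *m T.
  rewrite mulmx_suml mulmx_sumr.
  have -> : \sum_u aG (u * u)%g *m C = T *m C by rewrite mulmx_suml.
  have -> : \sum_u C *m aG (u * u)%g = C *m T by rewrite mulmx_sumr.
  rewrite /gsum mulmx_sumr mulmx_suml; apply: eq_bigr => g _.
  by rewrite -scalemxAr T_central -scalemxAl.
(* Centrality gives m T C = T C C = C T C, and [young_mid] evaluates each term C u u C. *)
have TC : T *m C = th *: C.
  apply: (scalerI young_norm_neq0).
  have dist (M : 'M_(gcard [set: 'S_k])) (F : 'S_k -> 'M_(gcard [set: 'S_k])) :
      M *m (\sum_u F u) *m M = \sum_u M *m F u *m M.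
    by rewrite mulmx_sumr mulmx_suml.
  rewrite scalemxAr -young_gsum_sqr mulmxA T_C dist.
  under eq_bigr => u _ do rewrite young_mid.
  rewrite -scaler_suml -mulr_sumr -scalerA; congr (_ *: (_ *: _)).
  rewrite [RHS](reindex_inj invg_inj) /=; apply: eq_bigr => u _.
  by rewrite invMg.
(* Replacing [u] by [u g] turns [u g^-1 u] into [u u g]. *)
have uCu : \sum_u aG u *m C^T *m aG u = T *m C.
  rewrite gsum_tr /gsum mulmx_sumr.
  under eq_bigr => u _ do rewrite mulmx_sumr mulmx_suml.
  rewrite exchange_big; apply: eq_bigr => g _ /=.
  rewrite -scalemxAr mulmx_suml (reindex_inj (mulIg g)) /= scaler_sumr.
  apply: eq_bigr => u _; rewrite -scalemxAr -scalemxAl -!regM.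
  by rewrite mulgK mulgA.
have trCC : \tr (C *m C^T) = N * \sum_g c g * c g.
  rewrite gsum_tr mulmx_sumr raddf_sum mulr_sumr; apply: eq_bigr => g _ /=.
  by rewrite -scalemxAr mxtraceZ gsum_trace mulrCA.
have trl : \tr (T *m C *m C^T) = m * (N * \sum_g c g * c g).
  rewrite -uCu mulmx_suml raddf_sum !mulr_sumr; apply: eq_bigr => u _ /=.
  have -> : aG u *m C^T *m aG u *m C^T = aG u *m (C *m aG u^-1%g *m C)^T.
    by rewrite !trmx_mul regular_trmx invgK !mulmxA.
  rewrite young_mid invgK linearZ /= -scalemxAr mxtraceZ.
  rewrite -[aG u]trmxK regular_trmx -trmx_mul mxtrace_tr gsum_trace.
  by rewrite -mulrA; congr (_ * _); rewrite mulrCA.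
move: trl; rewrite TC -scalemxAl mxtraceZ trCC => /mulIf; apply.
by rewrite mulf_neq0 ?card_G_neq0 ?young_sum_squares.
Qed.

Lemma specht_frobenius_schur : \sum_u specht_char a (u * u)%g = N.
Proof.
rewrite specht_char_ideal.
under eq_bigr => u _ do
  rewrite (ideal_charE young_norm_neq0 young_gsum_sqr).
rewrite -mulr_sumr exchange_big /=.
rewrite (eq_bigr (fun=> m)) => [|h _].
  by rewrite big_const iter_addr_0 mulrnAr mulVf ?young_norm_neq0 ?cardsT.
rewrite -[RHS]sum_young_coef_sqr.
rewrite [RHS](reindex_inj (h := fun u => (h * u^-1 * h^-1)%g)) /=.
  by apply: eq_bigr => u _; rewrite invMg !mulgA mulgKV.
by move=> u v /mulIg/mulgI/invg_inj.
Qed.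

Lemma specht_char_class g h : specht_char a (g ^ h)%g = specht_char a g.
Proof. by rewrite cfunJ ?inE. Qed.

End SpechtCharacter.

(** If no permutation separates one shape from the other, every product in the trace formula
    vanishes. Separation in both directions would make the shapes equal by [separates_eq]. *)
Lemma cfdot_specht_neq k (a b : intpartn k) :
  a != b -> '[specht_char a, specht_char b] = 0.
Proof.
move=> ne_ab.
have cross (x y : intpartn k) : ~~ [exists g, separates x y g] ->
    '[specht_char x, specht_char y] = 0.
  rewrite negb_exists => /forallP nsep; rewrite !specht_char_ideal.
  rewrite (cfdot_ideal_char2 (young_norm_neq0 x) (young_norm_neq0 y));
    rewrite ?young_gsum_sqr //.
  rewrite left_mul_mx_gsum_trace big1 ?mulr0 // => h _.
  have regM := @regular_reprM 'S_k.
  rewrite !young_gsum (row_col_mid regM) big1 ?mul0mx ?mxtrace0 // => q _.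
  by rewrite big1 // => p _; rewrite (row_col_sum0 regM) ?scaler0 ?nsep.
have [/existsP[g sep_ab]|] := boolP [exists g, separates a b g]; last exact: cross.
rewrite cfdotC cross ?conjC0 //; apply: contra ne_ab => /existsP[h sep_ba].
exact/eqP/(separates_eq sep_ab sep_ba).
Qed.

(** * Young's lattice *)

Section YoungLattice.

Implicit Type k : nat.
Local Open Scope nat_scope.

Lemma sumn_take (s : seq nat) r : sumn (take r s) = \sum_(x < r) nth 0 s x.
Proof.
elim: s r => [|y s IHs] [|r]; rewrite ?big_ord0 //=.
  by rewrite big1 // => i _; rewrite nth_nil.
by rewrite big_ord_recl /= IHs.
Qed.

Lemma size_part_le k (a : intpartn k) : size a <= k.
Proof. by have := size_le_sumn (part_notin0 a); rewrite sumn_part. Qed.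

Lemma sum_nth_part k (a : intpartn k) K : k <= K -> \sum_(x < K) nth 0 a x = k.
Proof.
move=> leK; rewrite -sumn_take take_oversize ?sumn_part //.
exact: leq_trans (size_part_le a) leK.
Qed.

Lemma nth_part_default k (a : intpartn k) x : k <= x -> nth 0 a x = 0.
Proof.
by move=> le_x; rewrite nth_default // (leq_trans (size_part_le a)).
Qed.

Lemma leq_sum_eq K (f g : nat -> nat) :
    (forall x, f x <= g x) -> \sum_(x < K) g x <= \sum_(x < K) f x ->
  forall x, x < K -> f x = g x.
Proof.
move=> le_fg le_sum x ltK.
have H := leqif_sum (P := predT) (fun (i : 'I_K) _ => leqif_eq (le_fg i)).
have := H.2; rewrite eqn_leq H.1 le_sum => /esym/forallP/(_ (Ordinal ltK)).
by move=> /eqP.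
Qed.

Lemma part_exists (p : nat -> nat) K n :
    (forall x, p x.+1 <= p x) -> (forall x, K <= x -> p x = 0) ->
    \sum_(x < K) p x = n ->
  exists a : intpartn n, forall x, nth 0 a x = p x.
Proof.
move=> p_dec p0 sum_p.
pose L := find (fun x => p x == 0) (iota 0 K).
have leLK : L <= K.
  by have := find_size (fun x => p x == 0) (iota 0 K); rewrite size_iota.
have p_anti x y : x <= y -> p y <= p x.
  by move=> /subnK <-; elim: (y - x) => // d IHd; apply: leq_trans (p_dec _) IHd.
have p_lt x : x < L -> 0 < p x.
  move=> lt_xL; have lt_xK : x < K.
    exact: leq_trans lt_xL leLK.
  by have := before_find 0 lt_xL; rewrite nth_iota // add0n lt0n => /negbT.
have p_ge x : L <= x -> p x = 0.
  move=> le_Lx; have [/p0 //|lt_xK] := leqP K x.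
  apply/eqP; rewrite -leqn0 (leq_trans (p_anti L _ _)) //.
  have: has (fun x => p x == 0) (iota 0 K).
    by rewrite has_find size_iota (leq_ltn_trans le_Lx).
  move=> has0; have := nth_find 0 has0; rewrite nth_iota //.
    by rewrite add0n -/L => /eqP ->.
  by rewrite (leq_ltn_trans le_Lx).
have nth_p x : nth 0 (mkseq p L) x = p x.
  have [lt_x|le_x] := ltnP x L; first by rewrite nth_mkseq.
  by rewrite nth_default ?size_mkseq // p_ge.
have part_p : is_part (mkseq p L) && (sumn (mkseq p L) == n).
  apply/andP; split; [apply/andP; split|].
  - apply/(sortedP 0) => i _; rewrite /geq /= !nth_p; exact: p_dec.
  - by apply/mapP => -[x]; rewrite mem_iota => /p_lt H e; rewrite -e in H.
  rewrite -[mkseq p L](take_oversize (n := K)) ?size_mkseq //.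
  by rewrite sumn_take -sum_p; apply/eqP/eq_bigr => x _.
by exists (IntPartn part_p).
Qed.

Definition covers k (a : intpartn k) (b : intpartn k.+1) :=
  [forall x : 'I_k.+1, nth 0 a x <= nth 0 b x].

Lemma coversP k (a : intpartn k) (b : intpartn k.+1) :
  reflect (forall x, nth 0 a x <= nth 0 b x) (covers a b).
Proof.
apply: (iffP forallP) => // H x; have [lt_x|le_x] := ltnP x k.+1.
  exact: (H (Ordinal lt_x)).
by rewrite nth_part_default // ltnW.
Qed.

Definition adds_at k (a : intpartn k) (b : intpartn k.+1) r :=
  [forall x : 'I_k.+1, nth 0 b x == nth 0 a x + (x == r :> nat)].

Lemma adds_atP k (a : intpartn k) (b : intpartn k.+1) (r : 'I_k.+1) :
  reflect (forall x, nth 0 b x = nth 0 a x + (x == r)) (adds_at a b r).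
Proof.
apply: (iffP forallP) => H x; last by rewrite H.
have [lt_x|le_x] := ltnP x k.+1; first exact/eqP/(H (Ordinal lt_x)).
rewrite !nth_part_default ?(ltnW le_x) //; case: eqP => // e.
by rewrite e leqNgt ltn_ord in le_x.
Qed.

Lemma covers_adds k (a : intpartn k) (b : intpartn k.+1) :
  covers a b -> exists r : 'I_k.+1, adds_at a b r.
Proof.
move/coversP => le_ab.
have sa := sum_nth_part a (leqnSn k); have sb := sum_nth_part b (leqnn k.+1).
have [/existsP[r lt_r]|] :=
  boolP [exists r : 'I_k.+1, nth 0 a r < nth 0 b r]; last first.
  rewrite negb_exists => /forallP no.
  suff : \sum_(x < k.+1) nth 0 b x <= \sum_(x < k.+1) nth 0 a x.
    by rewrite sa sb ltnn.
  by apply: leq_sum => x _; rewrite leqNgt no.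
exists r; apply/adds_atP => x.
have [lt_x|le_x] := ltnP x k.+1; last first.
  rewrite !nth_part_default ?(ltnW le_x) //; case: eqP => // e.
  by rewrite e leqNgt ltn_ord in le_x.
apply/esym; apply: (@leq_sum_eq k.+1 (fun x => nth 0 a x + (x == r))) => // [y|].
  by case: eqP => [->|_]; rewrite ?addn1 ?addn0 ?le_ab.
rewrite sb big_split /= sa (bigD1 r) //= eqxx big1 ?addn0 ?addn1 //.
by move=> y /negPf; rewrite -val_eqE /= => ->.
Qed.

Lemma adds_covers k (a : intpartn k) (b : intpartn k.+1) (r : 'I_k.+1) :
  adds_at a b r -> covers a b.
Proof. by move/adds_atP => H; apply/coversP => x; rewrite H leq_addr. Qed.

Lemma adds_at_inj k (a : intpartn k) (b : intpartn k.+1) (r s : 'I_k.+1) :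
  adds_at a b r -> adds_at a b s -> r = s.
Proof.
move=> /adds_atP Hr /adds_atP Hs; apply: val_inj; have := Hs r.
by rewrite Hr eqxx => /addnI; case: eqP.
Qed.

Lemma covers_sum k (a : intpartn k) (b : intpartn k.+1) :
  covers a b = \sum_(r < k.+1) adds_at a b r :> nat.
Proof.
have [cab|ncab] := boolP (covers a b); last first.
  by rewrite big1 // => r _; apply/eqP; rewrite eqb0; apply: contra ncab;
     apply: adds_covers.
have [r ar] := covers_adds cab; rewrite (bigD1 r) //= ar big1 // => s ne_sr.
by apply/eqP; rewrite eqb0; apply: contra ne_sr => /adds_at_inj/(_ ar) ->.
Qed.

Lemma card_sum_pred (T : finType) (P : pred T) :
  #|[set x | P x]| = \sum_x P x.
Proof.
by rewrite -sum1_card big_mkcond; apply: eq_bigr => x _; rewrite inE; case: (P x).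
Qed.

Lemma sum_pred_unique (T : finType) (P : pred T) (c : bool) :
    (forall x y, P x -> P y -> x = y) -> reflect (exists x, P x) c ->
  \sum_x P x = c.
Proof.
move=> uniqP; case: c / => [[x Px]|noP]; last first.
  by rewrite big1 // => x _; case Px: (P x) => //; case: noP; exists x.
rewrite (bigD1 x) //= Px big1 // => y ne_yx.
by case Py: (P y) => //; rewrite (uniqP y x) ?eqxx in ne_yx.
Qed.

Definition corners k (a : intpartn k) :=
  #|[set r : 'I_k | nth 0 a r.+1 < nth 0 a r]|.

Lemma corners_gt0 k (a : intpartn k.+1) : 0 < corners a.
Proof.
rewrite lt0n; apply/negP; rewrite cards_eq0 => /eqP no.
have a_le r : r <= k.+1 -> nth 0 a 0 <= nth 0 a r.
  elim: r => // r IHr lt_r; apply: leq_trans (IHr (ltnW lt_r)) _.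
  by have := in_set0 (Ordinal lt_r); rewrite -no inE ltnNge => /negbFE.
have := sum_nth_part a (leqnn k.+1); rewrite big1 // => x _.
apply/eqP; rewrite -leqn0 (leq_trans (nth_part_le a (leq0n x))) //.
by rewrite (leq_trans (a_le _ (leqnn _))) // nth_part_default.
Qed.

(** A cell can be added in row 0 or in a row just below a corner, hence one more place than there
    are corners. *)
Lemma card_covers k (a : intpartn k) : #|[set b | covers a b]| = (corners a).+1.
Proof.
rewrite card_sum_pred; under eq_bigr => b _ do rewrite covers_sum.
rewrite exchange_big /=.
pose addable (r : nat) := (r == 0) || (nth 0 a r < nth 0 a r.-1).
rewrite (eq_bigr (fun r : 'I_k.+1 => addable r : nat)) => [|r _].
  rewrite big_ord_recl /= add1n; congr _.+1.
  by rewrite /corners card_sum_pred.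
apply: sum_pred_unique => [b b' /adds_atP Hb /adds_atP Hb'|].
  by apply: part_eq_nth => x; rewrite Hb Hb'.
apply: (iffP idP) => [ad_r|[b /adds_atP Hb]]; last first.
  rewrite /addable; case: eqP => //= /eqP; rewrite -lt0n => r0.
  have := nth_part_le b (leq_pred r); rewrite !Hb eqxx.
  by have -> : (r.-1 == r :> nat) = false by [lia]; lia.
have [x|x||b Hb] := @part_exists (fun x => nth 0 a x + (x == r)) k.+1 k.+1.
- have := nth_part_le a (leqnSn x).
  case: (x.+1 =P r :> nat) => [e|_]; last by lia.
  by move: ad_r; rewrite /addable -e /=; case: (x == x.+1); lia.
- move=> le_x; rewrite nth_part_default ?(ltnW le_x) //; case: eqP => // e.
  by rewrite e leqNgt ltn_ord in le_x.
- rewrite big_split /= (sum_nth_part a (leqnSn k)).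
  rewrite (bigD1 r) //= eqxx big1 ?addn0 ?addn1 // => y /negPf.
  by rewrite -val_eqE /= => ->.
by exists b; apply/adds_atP.
Qed.

Lemma card_cocovers k (a : intpartn k.+1) :
  #|[set c | covers c a]| = corners a.
Proof.
rewrite card_sum_pred; under eq_bigr => b _ do rewrite covers_sum.
rewrite exchange_big /= /corners card_sum_pred; apply: eq_bigr => r _.
apply: sum_pred_unique => [b b' /adds_atP Hb /adds_atP Hb'|].
  by apply: part_eq_nth => x; apply: (@addIn (x == r)); rewrite -Hb -Hb'.
apply: (iffP idP) => [rm_r|[c /adds_atP Hc]]; last first.
  have := nth_part_le c (leqnSn r); rewrite !Hc eqxx.
  by have -> : (r.+1 == r :> nat) = false by [lia]; lia.
have [x|x||c Hc] := @part_exists (fun x => nth 0 a x - (x == r)) k.+1 k.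
- have := nth_part_le a (leqnSn x).
  by case: (x =P r :> nat) rm_r => [->|_]; case: (_ == _); lia.
- by move=> le_x; rewrite nth_part_default.
- have sum_a := sum_nth_part a (leqnn k.+1); move: sum_a.
  rewrite (bigD1 r) //= => sum_a; rewrite (bigD1 r) //= eqxx.
  rewrite [in LHS](eq_bigr (fun x : 'I_k.+1 => nth 0 a x)); first lia.
  by move=> y /negPf; rewrite -val_eqE /= => ->; rewrite subn0.
exists c; apply/adds_atP => x; rewrite Hc.
by case: eqP => [->|_]; lia.
Qed.

(** Both sides are 0 or 1: a common cover must be the union of the diagrams, a common lower
    neighbour their intersection. Their sizes add up to [k.+1 + k.+1], so one has the required size
    exactly when the other does. *)
Lemma card_common_covers k (a a' : intpartn k.+1) : a != a' ->
  #|[set b | covers a b && covers a' b]| = #|[set c | covers c a && covers c a']|.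
Proof.
move=> ne_aa'.
pose M x := maxn (nth 0 a x) (nth 0 a' x).
pose m x := minn (nth 0 a x) (nth 0 a' x).
have sumMm K : k.+1 <= K -> \sum_(x < K) M x + \sum_(x < K) m x = k.+1 + k.+1.
  move=> leK; transitivity (\sum_(x < K) nth 0 a x + \sum_(x < K) nth 0 a' x).
    rewrite -!big_split /=.
    by apply: eq_bigr => x _; rewrite /M /m; lia.
  by rewrite !sum_nth_part.
(* A union of only [k.+1] cells would be filled by each shape, making them equal. *)
have ltM : k.+1 < \sum_(x < k.+2) M x.
  rewrite ltnNge; apply: contra ne_aa' => leM; apply/eqP/part_eq_nth => x.
  have [lt_x|le_x] := ltnP x k.+2; last by rewrite !nth_part_default // ltnW.
  have eqM (c : intpartn k.+1) : (forall x, nth 0 c x <= M x) ->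
      nth 0 c x = M x.
    by move=> leM'; apply: leq_sum_eq lt_x; rewrite ?(sum_nth_part c) ?leqnSn.
  by rewrite eqM ?[RHS]eqM // => y; rewrite /M; lia.
have M_dec x : M x.+1 <= M x.
  by rewrite /M; have := nth_part_le a (leqnSn x); have := nth_part_le a' (leqnSn x); lia.
have m_dec x : m x.+1 <= m x.
  by rewrite /m; have := nth_part_le a (leqnSn x); have := nth_part_le a' (leqnSn x); lia.
have M0 x : k.+2 <= x -> M x = 0.
  by move=> le_x; rewrite /M !nth_part_default ?maxn0 // ltnW.
have m0 x : k.+1 <= x -> m x = 0.
  by move=> le_x; rewrite /m !nth_part_default ?min0n.
have split2 : \sum_(x < k.+2) M x = k.+2 <-> \sum_(x < k.+1) m x = k.
  have := sumMm k.+2 (leqnSn _).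
  rewrite [X in _ + X]big_ord_recr /= m0 // addn0; lia.
have defM (b : intpartn k.+2) : (forall x, M x <= nth 0 b x) ->
    forall x, nth 0 b x = M x.
  move=> leMb x; have [lt_x|le_x] := ltnP x k.+2; last first.
    by rewrite M0 // nth_part_default.
  by apply/esym; apply: (leq_sum_eq leMb) lt_x; rewrite sum_nth_part.
have defm (c : intpartn k) : (forall x, nth 0 c x <= m x) ->
    forall x, nth 0 c x = m x.
  move=> lecm x; have [lt_x|le_x] := ltnP x k.+1; last first.
    by rewrite m0 // nth_part_default // ltnW.
  apply: (leq_sum_eq lecm) lt_x; rewrite (sum_nth_part c (leqnSn k)).
  have := sumMm k.+2 (leqnSn _).
  rewrite [X in _ + X]big_ord_recr /= m0 // addn0; move: ltM.
  by move: (\sum_(x < k.+2) M x) (\sum_(i < k.+1) m i) => u v; lia.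
have upM (b : intpartn k.+2) : covers a b && covers a' b -> forall x, nth 0 b x = M x.
  by case/andP => /coversP H /coversP H'; apply: defM => x; rewrite geq_max H H'.
have dnm (c : intpartn k) : covers c a && covers c a' -> forall x, nth 0 c x = m x.
  by case/andP => /coversP H /coversP H'; apply: defm => x; rewrite leq_min H H'.
rewrite !card_sum_pred.
transitivity (\sum_(x < k.+2) M x == k.+2 : nat); last apply/esym.
  apply: sum_pred_unique => [b b' /upM Hb /upM Hb'|].
    by apply: part_eq_nth => x; rewrite Hb.
  apply: (iffP eqP) => [sM|[b /upM Hb]].
    have [b Hb] := part_exists M_dec M0 sM; exists b.
    by apply/andP; split; apply/coversP => x; rewrite Hb /M; lia.
  by rewrite -[RHS](sum_nth_part b (leqnn _)); apply: eq_bigr => x _; rewrite Hb.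
apply: sum_pred_unique => [c c' /dnm Hc /dnm Hc'|].
  by apply: part_eq_nth => x; rewrite Hc.
apply: (iffP eqP) => [/split2 sm|[c /dnm Hc]].
  have [c Hc] := part_exists m_dec m0 sm; exists c.
  by apply/andP; split; apply/coversP => x; rewrite Hc /m; lia.
apply/split2; rewrite -[RHS](sum_nth_part c (leqnSn _)).
by apply: eq_bigr => x _; rewrite Hc.
Qed.

End YoungLattice.

(** * The branching rule *)

Section Induction.

Variable k : nat.

Definition raise (w : 'S_k) : 'S_k.+1 := lift_perm ord_max ord_max w.

Lemma raiseM v w : raise (v * w) = (raise v * raise w)%g.
Proof. by rewrite /raise lift_permM. Qed.

Lemma raise1 : raise 1 = 1%g.
Proof. exact: lift_perm1. Qed.

Lemma raiseV w : raise w^-1 = (raise w)^-1%g.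
Proof. by rewrite /raise lift_permV. Qed.

Lemma raise_inj : injective raise.
Proof.
move=> v w eq_vw; apply/permP => i; apply: (@lift_inj _ ord_max).
by rewrite -!(lift_perm_lift ord_max) -/(raise v) eq_vw.
Qed.

Variable a : intpartn k.
Local Notation aG := (regular_repr algC [set: 'S_k.+1]).
Local Notation rho := (fun w : 'S_k => aG (raise w)).
Local Notation m := (young_norm a).

Lemma rhoM v w : rho (v * w)%g = rho v *m rho w.
Proof. by rewrite /= raiseM regular_reprM. Qed.

(** The Young symmetrizer of [a] viewed in the group algebra of S_(k+1). The right ideal it
    generates there is the module induced from the Specht module of [a]. *)
Definition ind_coef (g : 'S_k.+1) : algC :=
  \sum_w young_coef a w * (raise w == g)%:R.

Lemma ind_coef_raise w : ind_coef (raise w) = young_coef a w.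
Proof.
rewrite /ind_coef (bigD1 w) //= eqxx mulr1 big1 ?addr0 // => v ne_vw.
by rewrite (inj_eq raise_inj) (negPf ne_vw) mulr0.
Qed.

Lemma sum_ind_coef (F : 'S_k.+1 -> algC) :
  \sum_g ind_coef g * F g = \sum_w young_coef a w * F (raise w).
Proof.
rewrite /ind_coef; under eq_bigr => g _ do rewrite mulr_suml.
rewrite exchange_big; apply: eq_bigr => w _ /=.
rewrite (bigD1 (raise w)) //= eqxx mulr1 big1 ?addr0 // => g ne_g.
by rewrite eq_sym (negPf ne_g) mulr0 mul0r.
Qed.

Lemma ind_gsum : gsum ind_coef = row_sum rho a *m col_sum rho a.
Proof.
rewrite (row_col_sum rhoM) /gsum /ind_coef.
under eq_bigr => g _ do rewrite scaler_suml.
rewrite exchange_big; apply: eq_bigr => w _ /=.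
rewrite (bigD1 (raise w)) //= eqxx mulr1 big1 ?addr0 // => g ne_g.
by rewrite eq_sym (negPf ne_g) mulr0 scale0r.
Qed.

Lemma ind_gsum_sqr : gsum ind_coef *m gsum ind_coef = m *: gsum ind_coef.
Proof.
rewrite ind_gsum (young_symmetrizer_sqr rhoM) //.
by rewrite raise1 repr_mx1.
Qed.

Definition ind_char := ideal_char ind_coef.

Lemma card_raise : (#|[set: 'S_k.+1]|%:R : algC) = k.+1%:R * #|[set: 'S_k]|%:R.
Proof. by rewrite !cardsT !card_Sn factS natrM. Qed.

Lemma sum_ind_char (F : 'S_k.+1 -> algC) :
    (forall g h, F (g ^ h)%g = F g) ->
  \sum_g ind_char g * F g = k.+1%:R * \sum_w specht_char a w * F (raise w).
Proof.
move=> Fclass; rewrite (sum_ideal_char (young_norm_neq0 a) ind_gsum_sqr Fclass).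
rewrite specht_char_ideal.
rewrite (sum_ideal_char (young_norm_neq0 a) (young_gsum_sqr a)); last first.
  move=> v w; rewrite conjgE !raiseM raiseV -[RHS](Fclass _ (raise w)).
  by rewrite conjgE.
rewrite (sum_ind_coef (fun g => F g^-1%g)) card_raise -!mulrA mulrCA.
congr (_ * (_ * (_ * _))).
by apply: eq_bigr => w _; rewrite raiseV.
Qed.

Lemma ind_char1 : ind_char 1%g = k.+1%:R * specht_char a 1%g.
Proof.
rewrite specht_char_ideal (ideal_char1 (young_norm_neq0 a) (young_gsum_sqr a)).
rewrite (ideal_char1 (young_norm_neq0 a) ind_gsum_sqr) -[in ind_coef _]raise1.
by rewrite ind_coef_raise card_raise -!mulrA mulrCA.
Qed.

Variable b : intpartn k.+1.

Lemma res_repr_proof :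
  mx_repr [set: 'S_k] (fun w => specht_repr b (raise w)).
Proof.
split=> [|v w _ _]; first by rewrite raise1 repr_mx1.
by rewrite raiseM repr_mxM ?inE.
Qed.

Definition res_char : 'CF([set: 'S_k]) := cfRepr (MxRepresentation res_repr_proof).

Lemma res_charE w : res_char w = specht_char b (raise w).
Proof. by rewrite !cfunE !inE. Qed.

(** Frobenius reciprocity: by [cfdot_ideal_char] both sides apply a character of S_(k+1) to the same
    element, supported on the raised permutations. *)
Lemma cfdot_res_ind :
  '[res_char, specht_char a] = '[specht_char b, ind_char].
Proof.
rewrite [in LHS]specht_char_ideal.
rewrite (cfdot_ideal_char (young_norm_neq0 a) (young_gsum_sqr a)).
rewrite (cfdot_ideal_char (young_norm_neq0 a) ind_gsum_sqr) sum_ind_coef.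
by under eq_bigr => w _ do rewrite res_charE.
Qed.

(** Cells are numbered row by row, so inserting a cell with number [h] at the end of row [r] shifts
    the later numbers by one, exactly as [lift h] does. *)
Lemma lift_cell (h : 'I_k.+1) (i : 'I_k) r : (r < k.+1)%N ->
    (forall x, nth 0%N b x = (nth 0%N a x + (x == r))%N) ->
    h = flatten_index b r (nth 0%N a r) :> nat ->
  cell_row b (lift h i) = cell_row a i /\ cell_col b (lift h i) = cell_col a i.
Proof.
move=> lt_r nth_b def_h.
have lt_b : (cell_col a i < nth 0 b (cell_row a i))%N.
  by rewrite nth_b (leq_trans (cell_col_lt a i)) ?leq_addr.
suff def_i : lift h i = flatten_index b (cell_row a i) (cell_col a i) :> nat.
  by rewrite /cell_row /cell_col def_i flatten_indexKl ?flatten_indexKr.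
have sum_b y : sumn (take y b) = (sumn (take y a) + (r < y))%N.
  rewrite !sumn_take; under eq_bigr => x _ do rewrite nth_b.
  rewrite big_split /=; congr (_ + _)%N.
  have [lt_y|le_y] := ltnP r y; last first.
    by rewrite big1 // => x _; case: eqP => // e; have := ltn_ord x; lia.
  rewrite (bigD1 (Ordinal lt_y)) //= eqxx big1 // => x.
  by rewrite -val_eqE /= => /negPf ->.
have sum_mono y z : (y <= z)%N -> (sumn (take y a) <= sumn (take z a))%N.
  move=> le_yz; rewrite !sumn_take -[z in leqRHS](subnKC le_yz) big_split_ord /=.
  exact: leq_addr.
have sumS y : sumn (take y.+1 a) = (sumn (take y a) + nth 0 a y)%N.
  by rewrite !sumn_take big_ord_recr.
have def_val : i = (sumn (take (cell_row a i) a) + cell_col a i)%N :> nat.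
  by rewrite -[LHS](reshape_indexK a).
rewrite /= /bump def_h /flatten_index !sum_b ltnn addn0.
have lt_c := cell_col_lt a i.
have [lt_ri|le_ir] := ltnP r (cell_row a i).
  have := sum_mono _ _ lt_ri; rewrite sumS; lia.
have [lt_ir|le_ri] := ltnP (cell_row a i) r.
  have := sum_mono _ _ lt_ir; rewrite sumS; lia.
have e : cell_row a i = r by lia.
by move: lt_c def_val; rewrite e; lia.
Qed.

Lemma covers_lift : covers a b -> exists h : 'I_k.+1, forall i,
  cell_row b (lift h i) = cell_row a i /\ cell_col b (lift h i) = cell_col a i.
Proof.
move=> /covers_adds[r /adds_atP nth_b].
have lt_h : (flatten_index b r (nth 0 a r) < k.+1)%N.
  by rewrite -[X in (_ < X)%N](sumn_part b) flatten_indexP // nth_b eqxx addn1.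
by exists (Ordinal lt_h) => i; apply: (@lift_cell _ i r).
Qed.

(* If [h] is the cell of [b] missing from [a] then conjugation by
   [lift_perm ord_max h 1] maps the raised stabilizers of [a] into those of
   [b], whence [tr (A' B' pi B A pi^-1) = #|R_a| #|C_a| tr (A B) <> 0]. *)
Lemma ind_char_constt : covers a b -> '[specht_char b, ind_char] != 0.
Proof.
move=> /covers_lift[h cellE].
have regM := @regular_reprM 'S_k.+1.
have m0 := young_norm_neq0 a; have p0 := young_norm_neq0 b.
pose A := row_sum aG b; pose B := col_sum aG b.
(* Reversing the symmetrizer of [b] to [B A] brings the column sums together and, by cyclicity of
   the trace, the row sums too, so that both products collapse. *)
pose z g := young_coef b g^-1%g.
have trA : A^T = A.
  rewrite linear_sum (reindex_inj invg_inj) /=; apply: eq_big => [p|p _].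
    by rewrite (groupV (group (row_stab_group b))).
  by rewrite -regular_trmx trmxK.
have trB : B^T = B.
  rewrite linear_sum (reindex_inj invg_inj) /=; apply: eq_big => [p|p _].
    by rewrite (groupV (group (col_stab_group b))).
  by rewrite linearZ /= -regular_trmx trmxK odd_permV.
have defz : gsum z = B *m A.
  rewrite -trA.
  have -> : B *m A^T = (A *m B)^T by rewrite trmx_mul trB.
  rewrite -young_gsum gsum_tr /gsum (reindex_inj invg_inj) /=.
  by apply: eq_bigr => g _; rewrite /z invgK.
have zz : gsum z *m gsum z = young_norm b *: gsum z.
  have -> : gsum z = (gsum (young_coef b))^T.
    by rewrite defz young_gsum trmx_mul trA trB.
  by rewrite -trmx_mul young_gsum_sqr linearZ.
rewrite cfdotC fmorph_eq0 specht_char_ideal.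
rewrite (cfdot_ideal_char2 m0 p0 ind_gsum_sqr (young_gsum_sqr b)).
rewrite !mulf_neq0 ?invr_eq0 //.
have -> : \tr (left_mul_mx ind_coef *m gsum (young_coef b)) =
    \tr (left_mul_mx ind_coef *m gsum z).
  rewrite young_gsum defz -/A -/B mulmxA mxtrace_mulC mulmxA.
  suff -> : B *m left_mul_mx ind_coef = left_mul_mx ind_coef *m B.
    by rewrite mulmxA.
  rewrite /B /col_sum mulmx_suml mulmx_sumr; apply: eq_bigr => q _.
  by rewrite -scalemxAl -scalemxAr left_mul_mx_comm.
pose pi : 'S_k.+1 := lift_perm ord_max h 1.
apply: (trace_neq0_of_prod (g := pi) m0 p0 ind_gsum_sqr zz).
have raise_pi w : (raise w * pi = pi * lift_perm h h w)%g.
  by rewrite /raise /pi !lift_permM mulg1 mul1g.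
apply/eqP => /(congr1 (fun M => \tr (M *m aG pi^-1%g))).
rewrite mul0mx mxtrace0 ind_gsum defz.
have A_pi : row_sum rho a *m aG pi =
    aG pi *m \sum_(p in row_stab a) aG (lift_perm h h p).
  rewrite mulmx_suml mulmx_sumr; apply: eq_bigr => p _.
  by rewrite -!regM raise_pi.
have B_pi : col_sum rho a *m aG pi =
    aG pi *m \sum_(q in col_stab a) (-1) ^+ odd_perm q *: aG (lift_perm h h q).
  rewrite mulmx_suml mulmx_sumr; apply: eq_bigr => q _.
  by rewrite -scalemxAl -scalemxAr -!regM raise_pi.
have liftC q : q \in col_stab a -> lift_perm h h q \in col_stab b.
  move=> /mem_col_stab Cq; apply/mem_col_stab => x.
  case: (unliftP h x) => [i|] ->; last by rewrite lift_perm_id.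
  by rewrite lift_perm_lift !(cellE _).2 Cq.
have liftR p : p \in row_stab a -> lift_perm h h p \in row_stab b.
  move=> /mem_row_stab Rp; apply/mem_row_stab => x.
  case: (unliftP h x) => [i|] ->; last by rewrite lift_perm_id.
  by rewrite lift_perm_lift !(cellE _).1 Rp.
(* Lifting preserves the sign, so the two signs cancel and each term equals [B]. *)
have B_B : (\sum_(q in col_stab a) (-1) ^+ odd_perm q *: aG (lift_perm h h q))
    *m B = #|col_stab a|%:R *: B.
  rewrite mulmx_suml scaler_nat -sumr_const; apply: eq_bigr => q Cq.
  rewrite -scalemxAl (mul_col_sum regM) ?liftC // odd_lift_perm addbb addFb.
  by rewrite scalerA -signr_addb addbb scale1r.
have A_A : A *m (\sum_(p in row_stab a) aG (lift_perm h h p)) =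
    #|row_stab a|%:R *: A.
  rewrite mulmx_sumr scaler_nat -sumr_const; apply: eq_bigr => p Rp.
  by rewrite (row_sum_mul regM) ?liftR.
set Bh := \sum_(q in _) _ in B_pi B_B; set Ah := \sum_(p in _) _ in A_pi A_A.
rewrite mulmxA -[row_sum _ _ *m _ *m _]mulmxA B_pi [row_sum _ _ *m _]mulmxA A_pi.
rewrite mxtrace_mulC !mulmxA -regM mulVg repr_mx1 mul1mx.
rewrite -[Ah *m Bh *m B]mulmxA B_B -scalemxAr -scalemxAl mxtraceZ.
rewrite -mulmxA mxtrace_mulC -mulmxA A_A -scalemxAr mxtraceZ mxtrace_mulC.
rewrite -young_gsum mxtrace_young => /eqP; apply/negP.
rewrite !mulf_neq0 ?card_G_neq0 // pnatr_eq0 -lt0n.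
  exact: (cardG_gt0 (group (col_stab_group a))).
exact: (cardG_gt0 (group (row_stab_group a))).
Qed.

End Induction.

(** The constituents are split off one at a time; orthogonality ensures that removing some leaves
    the multiplicity of the next one unchanged. *)
Lemma char_sub_irr_sum (gT : finGroupType) (G : {group gT}) (I : finType)
    (P : pred I) (th : I -> 'CF(G)) (phi : 'CF(G)) :
    phi \is a character -> (forall i, th i \in irr G) ->
    (forall i j, i != j -> '[th i, th j] = 0) ->
    (forall i, P i -> '[phi, th i] != 0) ->
  exists2 psi, psi \is a character & phi = \sum_(i | P i) th i + psi.
Proof.
move=> phi_char th_irr th_orth phi_th.
rewrite -big_filter; set r := [seq i <- _ | P i].
have Ur : uniq r by rewrite filter_uniq ?index_enum_uniq.
have Pr : all P r by rewrite filter_all.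
elim: r Ur Pr => [|x r IHr] /=; first by exists phi; rewrite ?big_nil ?add0r.
case/andP=> x_r Ur /andP[Px Pr]; have [psi psi_char def_phi] := IHr Ur Pr.
have [j def_x] := irrP (th_irr x).
have : j \in irr_constt psi.
  rewrite irr_consttE -def_x; have := phi_th x Px.
  rewrite def_phi cfdotDl cfdot_suml big_seq big1 ?add0r // => i ri.
  by apply: th_orth; apply: contraNneq x_r => <-.
case/(constt_charP j psi_char) => psi' psi'_char def_psi.
exists psi'; rewrite // big_cons def_phi def_psi def_x addrCA addrA //.
Qed.

(** * Dimension count in Young's lattice *)

Local Notation dim_specht a := (specht_char a 1%g).

Lemma ind_char_decomp k (a : intpartn k) :
  exists2 psi : 'CF([set: 'S_k.+1]), psi \is a character &
    ind_char a = \sum_(b | covers a b) specht_char b + psi.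
Proof.
apply: char_sub_irr_sum => [|b|b b'|b ab].
- exact: ideal_char_is_char.
- exact: specht_char_irr.
- exact: cfdot_specht_neq.
by rewrite cfdotC fmorph_eq0 ind_char_constt.
Qed.

Lemma sum_dim_covers_le k (a : intpartn k) :
  \sum_(b | covers a b) dim_specht b <= k.+1%:R * dim_specht a.
Proof.
have [psi psi_char def_ind] := ind_char_decomp a.
by rewrite -ind_char1 def_ind cfunE sum_cfunE lerDl char1_ge0.
Qed.

Lemma sum_dim_cocovers_le k (b : intpartn k.+1) :
  \sum_(a | covers a b) dim_specht a <= dim_specht b.
Proof.
have [||||psi psi_char def_res] := @char_sub_irr_sum _ [set: 'S_k]%G _
  (fun a : intpartn k => covers a b) (@specht_char k) (res_char b).
- exact: cfRepr_char.
- exact: specht_char_irr.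
- exact: cfdot_specht_neq.
- by move=> a ab; rewrite cfdot_res_ind ind_char_constt.
have -> : dim_specht b = res_char b 1%g by rewrite res_charE raise1.
by rewrite def_res cfunE sum_cfunE lerDl char1_ge0.
Qed.

Lemma down_up_sum k (F : intpartn k -> algC) (a : intpartn k) :
  \sum_(b | covers a b) \sum_(a' | covers a' b) F a' =
  \sum_a' F a' *+ #|[set b | covers a b && covers a' b]|.
Proof.
rewrite (exchange_big_dep predT) //=; apply: eq_bigr => a' _.
by rewrite sumr_const; congr (_ *+ _); apply: eq_card => b; rewrite !inE.
Qed.

Lemma up_down_sum k (F : intpartn k.+1 -> algC) (a : intpartn k.+1) :
  \sum_(c | covers c a) \sum_(a' | covers c a') F a' =
  \sum_a' F a' *+ #|[set c | covers c a && covers c a']|.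
Proof.
rewrite (exchange_big_dep predT) //=; apply: eq_bigr => a' _.
by rewrite sumr_const; congr (_ *+ _); apply: eq_card => b; rewrite !inE.
Qed.

(** Off the diagonal the counts agree by [card_common_covers]; on it there is exactly one more cover
    than lower neighbours. *)
Lemma down_up_commute k (F : intpartn k.+1 -> algC) (a : intpartn k.+1) :
  \sum_(b | covers a b) \sum_(a' | covers a' b) F a' =
  F a + \sum_(c | covers c a) \sum_(a' | covers c a') F a'.
Proof.
rewrite down_up_sum up_down_sum (bigD1 a) //= [in RHS](bigD1 a) //= addrA.
congr (_ + _); last first.
  by apply: eq_bigr => a' ne_a'; rewrite card_common_covers // eq_sym.
rewrite -mulrS; congr (_ *+ _).
transitivity #|[set b | covers a b]|.
  by apply: eq_card => b; rewrite !inE andbb.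
rewrite card_covers -card_cocovers; congr _.+1.
by apply: eq_card => b; rewrite !inE andbb.
Qed.

Lemma down_up_commute0 (F : intpartn 0 -> algC) (a : intpartn 0) :
  \sum_(b | covers a b) \sum_(a' | covers a' b) F a' = F a.
Proof.
have eq_a a' : a' = a by apply: part_eq_nth => x; rewrite !nth_part_default.
rewrite down_up_sum (bigD1 a) //= big1 => [|a']; last by rewrite (eq_a a') eqxx.
rewrite addr0 -[RHS]mulr1n; congr (_ *+ _).
transitivity #|[set b | covers a b]|.
  by apply: eq_card => b; rewrite !inE andbb.
rewrite card_covers /corners; congr _.+1; apply/eqP; rewrite cards_eq0.
by apply/eqP/setP; case.
Qed.

Lemma sum_dim_covers k (a : intpartn k) :
  \sum_(b | covers a b) dim_specht b = k.+1%:R * dim_specht a.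
Proof.
(* Each inner sum is at most [dim_specht b], so this equality bounds the sum of the [dim_specht b]
   from below. *)
suff step j (x : intpartn j) :
    \sum_(b | covers x b) \sum_(x' | covers x' b) dim_specht x' =
      j.+1%:R * dim_specht x.
  apply/eqP; rewrite eq_le sum_dim_covers_le -step /=.
  by apply: ler_sum => b _; apply: sum_dim_cocovers_le.
elim: j x => [|j IHj] x; first by rewrite down_up_commute0 mul1r.
(* Pick [c] covered by [y]. Over the covers [b] of [c], the defects in the restriction inequality
   are nonnegative, and the induction hypothesis with the induction inequality makes their sum at
   most 0; so each vanishes, in particular at [y]. *)
have eq_dim (y : intpartn j.+1) :
    \sum_(c | covers c y) dim_specht c = dim_specht y.
  have /card_gt0P[c] : (0 < #|[set c | covers c y]|)%N.
    by rewrite card_cocovers corners_gt0.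
  rewrite inE => cy.
  have sum0 : \sum_(b | covers c b)
      (dim_specht b - \sum_(x' | covers x' b) dim_specht x') = 0.
    apply/eqP; rewrite eq_le sumr_ge0 ?andbT => [|b _]; last first.
      by rewrite subr_ge0 sum_dim_cocovers_le.
    by rewrite sumrB IHj subr_le0 sum_dim_covers_le.
  have /psumr_eq0P := sum0.
  move=> H; apply/esym/eqP; rewrite -subr_eq0; apply/eqP/H => // b _.
  by rewrite subr_ge0 sum_dim_cocovers_le.
have eq_cov (c : intpartn j) :
    \sum_(b | covers c b) dim_specht b = j.+1%:R * dim_specht c.
  by rewrite -IHj; apply: eq_bigr => b _; rewrite eq_dim.
rewrite down_up_commute (eq_bigr _ (fun c _ => eq_cov c)) -mulr_sumr eq_dim.
by rewrite -[in RHS]natr1 mulrDl mul1r addrC.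
Qed.

Theorem ind_char_specht k (a : intpartn k) :
  ind_char a = \sum_(b | covers a b) specht_char b.
Proof.
have [psi psi_char def_ind] := ind_char_decomp a.
have : psi 1%g = 0.
  have := ind_char1 a; rewrite def_ind cfunE sum_cfunE sum_dim_covers.
  by rewrite -[RHS]addr0 => /addrI.
by move/eqP; rewrite char1_eq0 // => /eqP psi0; rewrite def_ind psi0 addr0.
Qed.

Lemma specht_sum_branch k (a : intpartn k) (F : 'S_k.+1 -> algC) :
    (forall g h, F (g ^ h)%g = F g) ->
  \sum_(b | covers a b) \sum_g specht_char b g * F g =
    k.+1%:R * \sum_w specht_char a w * F (raise w).
Proof.
move=> Fclass; rewrite -sum_ind_char // ind_char_specht exchange_big /=.
by apply: eq_bigr => g _; rewrite sum_cfunE mulr_suml.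
Qed.

(** * Square roots of permutations *)

Section PermExt.

Variables (I T : finType) (f : I -> T).
Hypothesis f_inj : injective f.

Definition perm_ext_fun (s : {perm I}) x :=
  if [pick i | f i == x] is Some i then f (s i) else x.

Lemma perm_ext_funE s i : perm_ext_fun s (f i) = f (s i).
Proof.
rewrite /perm_ext_fun; case: pickP => [j /eqP/f_inj -> //|/(_ i)].
by rewrite eqxx.
Qed.

Lemma perm_ext_fun_out s x : x \notin codom f -> perm_ext_fun s x = x.
Proof.
rewrite /perm_ext_fun; case: pickP => [j /eqP <-|//].
by rewrite codom_f.
Qed.

Lemma perm_ext_fun_inj s : injective (perm_ext_fun s).
Proof.
move=> x y; have [/codomP[i ->]|fx] := boolP (x \in codom f);
  have [/codomP[j ->]|fy] := boolP (y \in codom f);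
  rewrite ?perm_ext_funE ?perm_ext_fun_out //.
- by move=> /f_inj/perm_inj ->.
- by move=> e; rewrite -e codom_f in fy.
- by move=> e; rewrite e codom_f in fx.
Qed.

Definition perm_ext s : {perm T} := perm (@perm_ext_fun_inj s).

Lemma perm_extE s i : perm_ext s (f i) = f (s i).
Proof. by rewrite permE perm_ext_funE. Qed.

Lemma perm_ext_out s x : x \notin codom f -> perm_ext s x = x.
Proof. by rewrite permE; apply: perm_ext_fun_out. Qed.

Lemma perm_extM s t : perm_ext (s * t) = (perm_ext s * perm_ext t)%g.
Proof.
apply/permP => x; have [/codomP[i ->]|fx] := boolP (x \in codom f).
  by rewrite permM !perm_extE permM.
by rewrite permM !perm_ext_out.
Qed.

Lemma perm_ext_inj : injective perm_ext.
Proof.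
by move=> s t e; apply/permP => i; apply: f_inj; rewrite -!perm_extE e.
Qed.

Lemma perm_ext1 : perm_ext 1 = 1%g.
Proof. by apply: (mulgI (perm_ext 1)); rewrite -perm_extM !mulg1. Qed.

Lemma perm_extV s : perm_ext s^-1 = (perm_ext s)^-1%g.
Proof.
by apply: (mulgI (perm_ext s)); rewrite -perm_extM !mulgV perm_ext1.
Qed.

Lemma perm_ext_onto (v : {perm T}) :
  (forall x, x \notin codom f -> v x = x) -> exists s, v = perm_ext s.
Proof.
move=> v_out.
have v_in i : v (f i) \in codom f.
  apply: contraT => out; have := v_out _ out => /perm_inj e.
  by rewrite e codom_f in out.
pose g i := iinv (v_in i).
have fg i : f (g i) = v (f i) by rewrite f_iinv.
have g_inj : injective g.
  by move=> i j e; apply/f_inj/(@perm_inj _ v); rewrite -!fg e.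
exists (perm g_inj); apply/permP => x.
have [/codomP[i ->]|fx] := boolP (x \in codom f).
  by rewrite perm_extE permE fg.
by rewrite v_out ?perm_ext_out.
Qed.

End PermExt.

Lemma widen_ord_injective k n (le_kn : (k <= n)%N) : injective (widen_ord le_kn).
Proof. by move=> i j /(congr1 val) /= e; apply: val_inj. Qed.

Definition widen_perm k n (le_kn : (k <= n)%N) : 'S_k -> 'S_n :=
  perm_ext (@widen_ord_injective k n le_kn).

Lemma codom_widen_ord k n (le_kn : (k <= n)%N) (x : 'I_n) :
  (x \in codom (widen_ord le_kn)) = (x < k)%N.
Proof.
apply/codomP/idP => [[i ->] //=|lt_x].
by exists (Ordinal lt_x); apply: val_inj.
Qed.

Lemma widen_perm_raise k n (lt_kn : (k < n)%N) (w : 'S_k) :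
  widen_perm lt_kn (raise w) = widen_perm (ltnW lt_kn) w.
Proof.
apply/permP => x; have [lt_x|le_x] := ltnP x k.
  have -> : x = widen_ord (ltnW lt_kn) (Ordinal lt_x) by apply: val_inj.
  rewrite [RHS]perm_extE.
  have -> : widen_ord (ltnW lt_kn) (Ordinal lt_x) =
      widen_ord lt_kn (lift ord_max (Ordinal lt_x)).
    by apply: val_inj; rewrite /= /bump leqNgt lt_x.
  rewrite [LHS]perm_extE lift_perm_lift; apply: val_inj.
  by rewrite /= /bump leqNgt ltn_ord.
rewrite [RHS]perm_ext_out ?codom_widen_ord -?leqNgt //.
have [lt_x|ltkx] := ltnP k x.
  by rewrite [LHS]perm_ext_out ?codom_widen_ord -?leqNgt.
have -> : x = widen_ord lt_kn ord_max.
  by apply: val_inj => /=; apply/eqP; rewrite eqn_leq ltkx.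
by rewrite [LHS]perm_extE lift_perm_id.
Qed.

Definition nb_sqrt k n (le_kn : (k <= n)%N) (w : 'S_k) : nat :=
  #|[set u : 'S_n | (u * u)%g == widen_perm le_kn w]|.

Lemma nb_sqrt_class k n (le_kn : (k <= n)%N) (g h : 'S_k) :
  nb_sqrt le_kn (g ^ h)%g = nb_sqrt le_kn g.
Proof.
pose H := widen_perm le_kn h; rewrite /nb_sqrt.
rewrite -[LHS](card_preimset _ (conjg_inj H)); apply: eq_card => u.
rewrite !inE -conjMg conjgE /widen_perm !perm_extM perm_extV -/H -conjgE.
by rewrite (inj_eq (conjg_inj H)).
Qed.

(** * The recursion for averages of square-root counts *)

Section Recursion.

Variables (n : nat).

Definition sqrt_mean k (le_kn : (k <= n)%N) (a : intpartn k) : algC :=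
  (k`!)%:R^-1 * \sum_w specht_char a w * (nb_sqrt le_kn w)%:R.

(** The branching rule is tested against the root count on S_(k+1), whose value at a raised
    permutation is the root count on S_k; the index [k.+1] cancels in the factorials. *)
Lemma sqrt_mean_branch k (lt_kn : (k < n)%N) (a : intpartn k) :
  sqrt_mean (ltnW lt_kn) a = \sum_(b | covers a b) sqrt_mean lt_kn b.
Proof.
rewrite /sqrt_mean -mulr_sumr.
rewrite (specht_sum_branch a (F := fun w => (nb_sqrt lt_kn w)%:R)); last first.
  by move=> g h; rewrite nb_sqrt_class.
rewrite factS natrM invfM -mulrA [_ * (k.+1%:R * _)]mulrCA mulKf ?pnatr_eq0 //.
congr (_ * _); apply: eq_bigr => w _; congr (_ * _%:R).
by rewrite /nb_sqrt widen_perm_raise.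
Qed.

(** Grouping the [u] by their square turns the average into the Frobenius-Schur sum. *)
Lemma sqrt_mean_full (a : intpartn n) : sqrt_mean (leqnn n) a = 1.
Proof.
rewrite /sqrt_mean.
have -> : \sum_w specht_char a w * (nb_sqrt (leqnn n) w)%:R =
    \sum_u specht_char a (u * u)%g.
  rewrite [RHS](partition_big (fun u => u * u)%g predT) //=; apply: eq_bigr => w _.
  rewrite [RHS](eq_bigr (fun=> specht_char a w)) => [|u /eqP <- //].
  rewrite sumr_const mulr_natr; congr (_ *+ _); apply: eq_card => u.
  rewrite !inE; congr (_ == _); apply/permP => i.
  have e : i = widen_ord (leqnn n) i by apply: val_inj.
  by rewrite [in LHS]e [LHS]perm_extE; apply: val_inj.
rewrite specht_frobenius_schur cardsT card_Sn mulVf //.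
by rewrite pnatr_eq0 -lt0n fact_gt0.
Qed.

End Recursion.

(** * Standard Young tableaux *)

Section Tableaux.

Local Open Scope nat_scope.

Implicit Types (t : seq (seq nat)) (r w : seq nat).

Lemma strictly_belowP r w :
  reflect (size w <= size r /\ forall j, j < size w -> nth 0 r j < nth 0 w j)
          (strictly_below r w).
Proof.
apply: (iffP andP) => -[le_w lt_w]; split=> //.
  by move=> j lt_j; apply: (allP lt_w); rewrite mem_iota.
by apply/allP => j; rewrite mem_iota => /lt_w.
Qed.

(** Rows out of range read as [[::]], which satisfies both conditions vacuously; a row about to be
    opened is then treated like any other. *)
Lemma is_sytP n t :
  reflect [/\ [::] \notin t, forall i, sorted ltn (nth [::] t i),
              forall i, strictly_below (nth [::] t i) (nth [::] t i.+1)
            & perm_eq (flatten t) (iota 1 n)]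
          (is_syt n t).
Proof.
apply: (iffP and4P) => [[/andP[_ t0] rows_t cols_t perm_t] | [t0 rows_t cols_t perm_t]].
  split=> // [|i|i].
  - by apply: contra t0 => t0; apply/mapP; exists [::].
  - have [lt_i|le_i] := ltnP i (size t); last by rewrite nth_default.
    by apply: (allP rows_t); rewrite mem_nth.
  have [lt_i|le_i] := ltnP i.+1 (size t); first exact/(sortedP [::]).
  by apply/strictly_belowP; rewrite [nth _ _ i.+1]nth_default.
split=> //; first last.
- by apply/(sortedP [::]) => i _.
- by apply/(all_nthP [::]).
apply/andP; split.
  apply/(sortedP 0) => i; rewrite size_map => lt_i.
  have /strictly_belowP[le_sz _] := cols_t i.
  by rewrite !(nth_map [::]) // ltnW.
by apply: contra t0 => /mapP[r rt /esym/size0nil <-].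
Qed.

Lemma mem_syt_le n t i x : is_syt n t -> x \in nth [::] t i -> x <= n.
Proof.
case/is_sytP=> _ _ _ perm_t xt; have : x \in flatten t.
  have [lt_i|le_i] := ltnP i (size t); last by rewrite nth_default in xt.
  by apply/flattenP; exists (nth [::] t i); rewrite ?mem_nth.
by rewrite (perm_mem perm_t) mem_iota; lia.
Qed.

(** For [i = size t] this opens a new row. *)
Definition add_cell t i m := set_nth [::] t i (rcons (nth [::] t i) m).

Lemma nth_add_cell t i m j : nth [::] (add_cell t i m) j =
  if j == i then rcons (nth [::] t i) m else nth [::] t j.
Proof. by rewrite nth_set_nth. Qed.

Lemma add_cellE t i m : i <= size t ->
  add_cell t i m = take i t ++ rcons (nth [::] t i) m :: drop i.+1 t.
Proof.
move=> le_i; rewrite /add_cell set_nthE; case: ltnP => // ge_i.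
have -> : i = size t by apply/eqP; rewrite eqn_leq le_i.
by rewrite subnn take_size drop_oversize.
Qed.

Lemma flatten_split t i :
  flatten t = flatten (take i t) ++ nth [::] t i ++ flatten (drop i.+1 t).
Proof.
have [lt_i|le_i] := ltnP i (size t).
  by rewrite -[in LHS](cat_take_drop i t) (drop_nth [::] lt_i) flatten_cat.
rewrite take_oversize // nth_default // drop_oversize ?cats0 //.
exact: leqW.
Qed.

Lemma perm_flatten_add_cell t i m : i <= size t ->
  perm_eq (flatten (add_cell t i m)) (m :: flatten t).
Proof.
move=> le_i; rewrite add_cellE // [flatten t](flatten_split _ i) flatten_cat /=.
rewrite -cats1 -!catA perm_sym -cat1s perm_catCA perm_cat2l perm_catCA.
by rewrite perm_refl.
Qed.

Lemma nth_shape t j : nth 0 (shape t) j = size (nth [::] t j).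
Proof.
have [lt_j|le_j] := ltnP j (size t); first by rewrite (nth_map [::]).
by rewrite !nth_default ?size_map.
Qed.

Lemma nth_shape_add_cell t i m j :
  nth 0 (shape (add_cell t i m)) j = nth 0 (shape t) j + (j == i).
Proof.
rewrite !nth_shape nth_add_cell; case: eqP => [->|_]; last by rewrite addn0.
by rewrite size_rcons addn1.
Qed.

Lemma subtableau_add_cell k t i m : i <= size t -> k < m ->
  subtableau k (add_cell t i m) = subtableau k t.
Proof.
move=> le_i lt_km; rewrite add_cellE // /subtableau.
have [lt_i|ge_i] := ltnP i (size t).
  rewrite -[in RHS](cat_take_drop i t) (drop_nth [::] lt_i) !map_cat /=.
  by rewrite filter_rcons leqNgt lt_km.
have -> : i = size t by apply/eqP; rewrite eqn_leq le_i.
rewrite take_size drop_oversize // nth_default // map_cat filter_cat /=.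
by rewrite leqNgt lt_km cats0.
Qed.

Lemma subtableau_syt n t : is_syt n t -> subtableau n t = t.
Proof.
move=> syt_t; have [t0 _ _ _] := is_sytP _ _ syt_t; rewrite /subtableau.
have -> : [seq [seq x <- r | x <= n] | r <- t] = t.
  rewrite -[RHS]map_id; apply/eq_in_map => r rt; apply/all_filterP/allP => x xr.
  by apply: (@mem_syt_le n t (index r t)); rewrite ?nth_index.
by apply/all_filterP/allP => r rt; apply: contraNneq t0 => <-.
Qed.

Lemma subtableau_subtableau k l t : k <= l ->
  subtableau k (subtableau l t) = subtableau k t.
Proof.
move=> le_kl; rewrite /subtableau; elim: t => //= r t IHt.
have filtr : [seq x <- [seq x <- r | x <= l] | x <= k] = [seq x <- r | x <= k].
  rewrite -filter_predI; apply: eq_filter => x /=.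
  by case: leqP => //= /leq_trans; apply.
case: ([seq x <- r | x <= l] =P [::]) => [e|_] /=; last by rewrite filtr IHt.
by rewrite -filtr e /= IHt.
Qed.

Lemma iota1S n : iota 1 n.+1 = rcons (iota 1 n) n.+1.
Proof. by rewrite -cats1 -[n.+1 in LHS]addn1 iotaD add1n. Qed.

Lemma add_cell_syt n t i : is_syt n t -> i <= size t ->
    (forall j, j.+1 = i -> size (nth [::] t i) < size (nth [::] t j)) ->
  is_syt n.+1 (add_cell t i n.+1).
Proof.
move=> syt_t le_i addable; have [t0 rows_t cols_t perm_t] := is_sytP _ _ syt_t.
apply/is_sytP; split=> [|j|j|].
- rewrite add_cellE // mem_cat inE -[rcons _ _]cats1 !negb_or.
  apply/and3P; split; last 1 first.
  + by apply: contra t0 => /mem_drop.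
  + by apply: contra t0 => /mem_take.
  by case: (nth _ _ _).
- rewrite nth_add_cell; case: eqP => // _.
  have := rows_t i; have := @mem_syt_le n t i ^~ syt_t.
  case: (nth [::] t i) => //= x s le_s srt.
  by rewrite rcons_path srt /= ltnS le_s ?mem_last.
- rewrite !nth_add_cell; have /strictly_belowP[le_sz lt_nth] := cols_t j.
  have [->|ne_ji] := j =P i.
    have -> : (i.+1 == i) = false by lia.
    have /strictly_belowP[le_szi lt_nthi] := cols_t i.
    apply/strictly_belowP; rewrite size_rcons; split=> [|c lt_c]; first lia.
    by rewrite nth_rcons (leq_trans lt_c) // lt_nthi.
  case: eqP => // def_i; apply/strictly_belowP; rewrite size_rcons.
  rewrite def_i in le_sz lt_nth *.
  split=> [|c]; first exact: addable.
  rewrite ltnS leq_eqVlt nth_rcons => /orP[/eqP ->|lt_c].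
    rewrite ltnn eqxx ltnS (@mem_syt_le n t j) // mem_nth //.
    exact: addable.
  by rewrite lt_c lt_nth.
apply: perm_trans (perm_flatten_add_cell _ le_i) _.
by rewrite iota1S perm_sym perm_rcons perm_cons perm_sym.
Qed.

Lemma sorted_ltn_rcons w x : sorted ltn (rcons w x) -> {in w, forall y, y < x}.
Proof.
move=> srt y yw; have lt_y : index y w < size w by rewrite index_mem.
have := sorted_ltn_nth ltn_trans 0 srt (index y w) (size w).
rewrite !inE size_rcons ltnS (ltnW lt_y) leqnn !nth_rcons lt_y ltnn eqxx.
by rewrite nth_index //; apply.
Qed.

(** The largest entry ends its row and has nothing below it, so deleting it leaves a tableau. *)
Lemma syt_add_cell_exists n t : is_syt n.+1 t ->
  exists i t', [/\ is_syt n t', i <= size t' & t = add_cell t' i n.+1].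
Proof.
move=> syt_t; have [t0 rows_t cols_t perm_t] := is_sytP _ _ syt_t.
have /flattenP[row row_t m_row] : n.+1 \in flatten t.
  by rewrite (perm_mem perm_t) mem_iota; lia.
have lt_i : index row t < size t by rewrite index_mem.
have := nth_index [::] row_t; move: (index row t) lt_i => i lt_i nth_i.
have [w def_row] : exists w, row = rcons w n.+1.
  move: (rows_t i) (@mem_syt_le _ _ i ^~ syt_t); rewrite nth_i.
  case/lastP: row {row_t nth_i} m_row => // w x m_wx srt le_wx; exists w.
  congr rcons; apply/eqP; rewrite eqn_leq le_wx ?mem_rcons ?mem_head //=.
  move: m_wx; rewrite mem_rcons inE => /predU1P[->//|].
  by move/(sorted_ltn_rcons srt)/ltnW.
rewrite {}def_row {row row_t m_row} in nth_i.
(* An entry below the cell of [n.+1] would have to exceed [n.+1]. *)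
have le_next : size (nth [::] t i.+1) <= size w.
  have /strictly_belowP[] := cols_t i; rewrite nth_i size_rcons => le_sz lt_nth.
  rewrite leqNgt; apply/negP => lt_w; have := lt_nth _ lt_w.
  rewrite nth_rcons ltnn eqxx ltnNge (@mem_syt_le _ _ i.+1 _ syt_t) //.
  exact: mem_nth.
have last_row : w = [::] -> size t = i.+1.
  move=> w0; apply/eqP; rewrite eqn_leq lt_i andbT leqNgt.
  apply: contra t0 => lt_Si; rewrite w0 leqn0 size_eq0 in le_next.
  by rewrite -(eqP le_next) mem_nth.
(* Empty rows are not allowed: a row emptied by the deletion is dropped, and [last_row] shows that
   it was the last one. *)
pose t' := if w == [::] then take i t else set_nth [::] t i w.
have nth_t' j : nth [::] t' j = if j == i then w else nth [::] t j.
  rewrite /t'; case: (w =P [::]) => [w0|_]; last by rewrite nth_set_nth.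
  have [lt_ji|le_ij] := ltnP j i.
    by rewrite nth_take // ltn_eqF.
  rewrite nth_default ?size_take ?lt_i //; case: eqP => // ne_ji.
  by rewrite nth_default // (last_row w0); lia.
have size_t' : size t' = if w == [::] then i else size t.
  rewrite /t'; case: eqP => [w0|_]; first by rewrite size_take lt_i.
  by rewrite size_set_nth; apply/maxn_idPr.
have le_i : i <= size t' by rewrite size_t'; case: ifP => // _; apply: ltnW.
have def_t : t = add_cell t' i n.+1.
  apply: (@eq_from_nth _ [::]) => [|j _].
    rewrite size_set_nth size_t'; case: eqP => [/last_row ->|_]; last by lia.
    by apply/esym/maxn_idPl.
  rewrite nth_add_cell !nth_t' eqxx.
  by case: eqP => // ->.
exists i, t'; split=> //; apply/is_sytP; split=> [|j|j|].
- rewrite /t'; case: eqP => [_|w0]; first by apply: contra t0 => /mem_take.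
  rewrite set_nthE lt_i mem_cat inE !negb_or; apply/and3P; split.
  + by apply: contra t0 => /mem_take.
  + by apply/eqP => /esym.
  by apply: contra t0 => /mem_drop.
- rewrite nth_t'; case: eqP => // _; have := rows_t i; rewrite nth_i.
  exact/(subseq_sorted ltn_trans)/subseq_rcons.
- rewrite !nth_t'; have /strictly_belowP[le_sz lt_nth] := cols_t j.
  have [def_j|ne_ji] := j =P i.
    have -> : (j.+1 == i) = false by lia.
    apply/strictly_belowP; rewrite def_j; split=> // c lt_c.
    have := lt_nth c; rewrite def_j nth_i nth_rcons (leq_trans lt_c le_next).
    exact.
  case: eqP => // def_i; rewrite def_i nth_i size_rcons in le_sz lt_nth.
  apply/strictly_belowP; split=> [|c lt_c]; first exact: ltnW.
  by have := lt_nth c (ltnW lt_c); rewrite nth_rcons lt_c.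
rewrite -(perm_cons n.+1); apply: perm_trans (_ : perm_eq _ (flatten t)) _.
  by rewrite perm_sym {1}def_t perm_flatten_add_cell.
apply: (perm_trans perm_t).
by rewrite iota1S perm_rcons.
Qed.

Lemma syt_subtableau n k t : k <= n -> is_syt n t -> is_syt k (subtableau k t).
Proof.
move=> /subnK <-; elim: (n - k) t => [|d IHd] t; first by move=> /[dup]/subtableau_syt ->.
rewrite addSn => /syt_add_cell_exists[i [t' [syt_t' le_i ->]]].
by rewrite subtableau_add_cell ?IHd // ltnS leq_addl.
Qed.

End Tableaux.

(** * Shapes of tableaux and the recursion for the number of extensions *)

Section TableauShapes.

Local Open Scope nat_scope.

Lemma shape_part_proof k (T : syt k) :
  is_part (shape T) && (sumn (shape T) == k).
Proof.
have /and4P[-> _ _ perm_T] := valP T.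
by rewrite -size_flatten (perm_size perm_T) size_iota eqxx.
Qed.

Definition shape_part k (T : syt k) : intpartn k := IntPartn (shape_part_proof T).

Lemma nb_syt_containing_full k (T : syt k) : nb_syt_containing k T = 1.
Proof.
rewrite /nb_syt_containing (_ : [set S | _] = [set T]) ?cards1 //.
by apply/setP => S; rewrite !inE subtableau_syt ?(valP S).
Qed.

Lemma sum_nb_syt_containing k n (lt_kn : k < n) (T : syt k) :
  nb_syt_containing n T =
  \sum_(T' : syt k.+1 | subtableau k T' == T) nb_syt_containing n T'.
Proof.
pose restr (S : syt n) : syt k.+1 := Syt (syt_subtableau lt_kn (valP S)).
have sub_restr S : subtableau k (restr S) = subtableau k S.
  by rewrite subtableau_subtableau.
rewrite /nb_syt_containing -sum1_card.
rewrite (partition_big restr (fun T' : syt k.+1 => subtableau k T' == T)) /=.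
  apply: eq_bigr => T' /eqP sub_T'; rewrite -sum1_card; apply: eq_bigl => S.
  rewrite !inE -val_eqE /= andbC; case: (subtableau k.+1 S =P T') => //= e.
  by rewrite -sub_restr /= e sub_T' eqxx.
by move=> S; rewrite inE sub_restr.
Qed.

Lemma subtableau_eq k (T' : syt k.+1) (T : syt k) : subtableau k T' = T ->
  exists i, i <= size T /\ rows T' = add_cell T i k.+1.
Proof.
have [i [t [syt_t le_i ->]]] := syt_add_cell_exists (valP T').
by rewrite subtableau_add_cell // (subtableau_syt syt_t) => <-; exists i.
Qed.

(** The new shape determines the cell of [k.+1], so [T] has at most one extension by one cell of a
    given shape. *)
Lemma sum_subtableau_shape k (T : syt k) (b : intpartn k.+1) :
  \sum_(T' : syt k.+1) ((subtableau k T' == T) && (shape_part T' == b)) =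
    covers (shape_part T) b.
Proof.
apply: sum_pred_unique => [T1 T2|].
  move=> /andP[/eqP/subtableau_eq[i [_ def1]] /eqP sh1].
  move=> /andP[/eqP/subtableau_eq[j [_ def2]] /eqP sh2].
  apply: val_inj => /=; rewrite def1 def2.
  suff -> : i = j by [].
  have := congr1 (fun p : intpartn _ => nth 0 p i) (etrans sh1 (esym sh2)).
  by rewrite /= def1 def2 !nth_shape_add_cell eqxx => /addnI; case: eqP.
apply: (iffP idP) => [/covers_adds[r /adds_atP nth_b]|]; last first.
  case=> T' /andP[/eqP/subtableau_eq[i [_ def_T']] /eqP <-].
  by apply/coversP => x; rewrite /= def_T' nth_shape_add_cell leq_addr.
(* A row added beyond the first empty one would lie below an empty row of [b]. *)
have le_r : r <= size T.
  have [->//|r0] := posnP (r : nat).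
  have := nth_part_le b (leq_pred r); rewrite !nth_b eqxx /=.
  have -> : (r.-1 == r :> nat) = false by lia.
  have [lt_r|ge_r] := ltnP r.-1 (size T); first by lia.
  have -> : nth 0 (shape T) r.-1 = 0 by rewrite nth_shape nth_default.
  lia.
have syt_T' : is_syt k.+1 (add_cell T r k.+1).
  apply: (add_cell_syt (valP T)) => // j def_r; rewrite -!nth_shape.
  have := nth_part_le b (leqnSn j); rewrite !nth_b def_r eqxx /=.
  have -> : (j == r :> nat) = false by lia.
  by rewrite addn1 addn0.
exists (Syt syt_T'); rewrite /= subtableau_add_cell // subtableau_syt ?(valP T) //.
rewrite eqxx /=; apply/eqP/part_eq_nth => x.
by rewrite /= nth_shape_add_cell nth_b.
Qed.

End TableauShapes.

Lemma nb_syt_containing_sqrt k n (le_kn : (k <= n)%N) (T : syt k) :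
  (nb_syt_containing n T)%:R = sqrt_mean le_kn (shape_part T).
Proof.
(* The recursion increases [k] towards the fixed [n], hence the induction on [n - k]. *)
move: T; have [d] := ubnP (n - k); elim: d k le_kn => // d IHd k le_kn lt_d T.
have [eq_kn|lt_kn] := eqVneq k n.
  case: _ / eq_kn in le_kn *.
  rewrite nb_syt_containing_full (bool_irrelevance le_kn (leqnn k)).
  by rewrite sqrt_mean_full.
have lt_kn' : (k < n)%N by rewrite ltn_neqAle lt_kn.
rewrite (bool_irrelevance le_kn (ltnW lt_kn')) sqrt_mean_branch.
rewrite (sum_nb_syt_containing lt_kn') natr_sum.
rewrite (eq_bigr (fun T' => sqrt_mean lt_kn' (shape_part T'))) => [|T' _]; last first.
  by rewrite (IHd _ lt_kn') //; lia.
rewrite (partition_big (@shape_part _) predT) //= [RHS]big_mkcond /=.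
apply: eq_bigr => b _.
rewrite (eq_bigr (fun=> sqrt_mean lt_kn' b)) => [|T' /andP[_ /eqP -> //]].
have := sum_subtableau_shape T b.
rewrite sumr_const -card_sum_pred => card_b.
have -> : #|[pred T' : syt k.+1 | (subtableau k T' == T) && (shape_part T' == b)]|
    = covers (shape_part T) b.
  by rewrite -card_b; apply: eq_card => T'; rewrite !inE.
by case: (covers _ _).
Qed.

(** * Cycle types *)

Section Orbits.

Variable T : finType.
Implicit Types (s t v : {perm T}) (x y : T).

Lemma iter_porbit_mod s x a : iter (a %% #|porbit s x|) s x = iter a s x.
Proof.
rewrite [in RHS](divn_eq a #|porbit s x|) addnC iterD; congr (iter _ _ _).
by elim: (a %/ _)%N => // q IHq; rewrite mulSn iterD -IHq iter_porbit.
Qed.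

Lemma card_porbit_gt0 s x : (0 < #|porbit s x|)%N.
Proof. by rewrite lt0n card_porbit_neq0. Qed.

Lemma eq_iter_porbit s x a b :
  (iter a s x == iter b s x) = (a == b %[mod #|porbit s x|]).
Proof.
rewrite -(iter_porbit_mod s x a) -(iter_porbit_mod s x b).
have lt c : (c %% #|porbit s x| < #|porbit s x|)%N by rewrite ltn_mod card_porbit_gt0.
rewrite -(nth_traject _ (lt a)) -(nth_traject _ (lt b)).
by rewrite nth_uniq ?size_traject ?uniq_traject_porbit.
Qed.

Lemma iter_porbit_dvd s x a : (iter a s x == x) = (#|porbit s x| %| a)%N.
Proof. by rewrite -[x in _ == x]/(iter 0 s x) eq_iter_porbit mod0n. Qed.

Lemma card_porbit_eq s x d :
  (forall a, (iter a s x == x) = (d %| a)%N) -> #|porbit s x| = d.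
Proof.
move=> H; apply/eqP; rewrite eqn_dvd -iter_porbit_dvd H dvdnn /=.
by rewrite -H iter_porbit_dvd.
Qed.

Lemma card_porbit_sqr s x : #|porbit (s * s) x| =
  if odd #|porbit s x| then #|porbit s x| else #|porbit s x|./2.
Proof.
apply: card_porbit_eq => a.
have -> : iter a (s * s)%g x = iter (2 * a)%N s x.
  by elim: a => // a IHa; rewrite mulnS iterD -IHa /= permM.
rewrite iter_porbit_dvd; case: ifP => [odd_o|/negbT even_o].
  by rewrite Gauss_dvdr // coprimen2.
by rewrite -[X in (X %| _)%N](even_halfK even_o) -muln2 mulnC dvdn_pmul2l.
Qed.

(** Points are counted instead of cycles, so squares can be analysed pointwise;
    [nb_in_cycles_porbits] recovers the multiplicity up to the factor [i]. *)
Definition nb_in_cycles s i := #|[set x | #|porbit s x| == i]|.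

Lemma nb_in_cycles0 s : nb_in_cycles s 0 = 0%N.
Proof.
apply/eqP; rewrite cards_eq0; apply/eqP/setP => x; rewrite !inE.
by rewrite (negPf (card_porbit_neq0 _ _)).
Qed.

Lemma nb_in_cycles_big s i : (#|T| < i)%N -> nb_in_cycles s i = 0%N.
Proof.
move=> lt_i; apply/eqP; rewrite cards_eq0; apply/eqP/setP => x; rewrite !inE.
by rewrite ltn_eqF // (leq_ltn_trans (max_card _)).
Qed.

Lemma sum_nb_in_cycles s : (\sum_(i < #|T|.+1) nb_in_cycles s i)%N = #|T|.
Proof.
rewrite -[RHS]cardsT -[RHS]sum1_card.
rewrite (partition_big (fun x => inord #|porbit s x| : 'I_#|T|.+1) predT) //=.
apply: eq_bigr => i _; rewrite /nb_in_cycles -sum1_card; apply: eq_bigl => x.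
rewrite !inE /= -val_eqE /= inordK // ltnS; exact: max_card.
Qed.

Lemma nb_in_cycles_porbits s i : nb_in_cycles s i =
  (count_mem i [seq #|C| | C : {set T} <- enum (porbits s)] * i)%N.
Proof.
rewrite count_map -sum1_count big_enum_cond /= big_distrl /=.
rewrite /nb_in_cycles -sum1_card.
rewrite (partition_big (porbit s) (fun C => (C \in porbits s) && (#|C| == i))) /=.
  apply: eq_bigr => C /andP[/imsetP[y _ ->] /eqP card_y].
  rewrite mul1n -[RHS]card_y -[RHS]sum1_card; apply: eq_bigl => x.
  rewrite inE eq_porbit_mem; case: (boolP (x \in _)) => [|_]; last by rewrite andbF.
  by rewrite -eq_porbit_mem => /eqP ->; rewrite card_y eqxx.
by move=> x; rewrite inE imset_f.
Qed.

(** Under squaring a cycle of odd length survives, and a cycle of length [i.*2] splits into two of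
    length [i]. As points are counted, no factor 2 appears. *)
Lemma nb_in_cycles_sqr s i :
  nb_in_cycles (s * s) i = (odd i * nb_in_cycles s i + nb_in_cycles s i.*2)%N.
Proof.
rewrite /nb_in_cycles -(cardsID [set x | odd #|porbit s x|]); congr (_ + _)%N.
  case odd_i: (odd i); rewrite ?mul1n ?mul0n.
    apply: eq_card => x; rewrite !inE card_porbit_sqr.
    by case: ifP; rewrite ?andbT ?andbF //; case: eqP => // ->; rewrite odd_i.
  apply/eqP; rewrite cards_eq0; apply/eqP/setP => x; rewrite !inE card_porbit_sqr.
  by case: ifP; rewrite ?andbF // andbT => odd_x; apply/negP => /eqP e;
     rewrite -e odd_x in odd_i.
apply: eq_card => x; rewrite !inE card_porbit_sqr.
case: ifP => [odd_x|/negbT even_x] /=.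
  by apply/esym/negP => /eqP e; rewrite e odd_double in odd_x.
by rewrite -[in RHS](even_halfK even_x) (inj_eq double_inj).
Qed.

End Orbits.

(** Orbits of equal length are matched, a base point is chosen in each, and the conjugator carries
    the [m]-th iterate of one base point to the [m]-th iterate of the other. *)
Lemma conj_of_cycle_type (T : finType) (s t : {perm T}) :
    perm_eq [seq #|C| | C : {set T} <- enum (porbits s)]
            [seq #|C| | C : {set T} <- enum (porbits t)] ->
  exists g : {perm T}, (s ^ g)%g = t.
Proof.
move=> eq_type.
(* [Is] reorders the orbits of [t] so that lengths match those of [s] position by position. *)
have [Is perm_Is def_s] := perm_iotaP 0%N eq_type.
set os := enum (porbits s) in def_s eq_type.
set ot := enum (porbits t) in perm_Is def_s eq_type.
rewrite size_map in perm_Is.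
pose ot' := [seq nth set0 ot i | i <- Is].
have perm_ot : perm_eq ot' ot.
  rewrite -[X in perm_eq _ X](mkseq_nth set0) /mkseq; exact: perm_map.
have sz_ot' : size ot' = size os.
  by rewrite size_map -(size_map (fun C : {set T} => #|C|) os) def_s size_map.
have uniq_ot' : uniq ot' by rewrite (perm_uniq perm_ot) enum_uniq.
have card_ot' i : (i < size os)%N -> #|nth set0 ot' i| = #|nth set0 os i|.
  move=> lt_i; rewrite -(nth_map set0 0%N (fun C : {set T} => #|C|)) ?sz_ot' //.
  rewrite -(nth_map set0 0%N (fun C : {set T} => #|C|) lt_i) def_s.
  congr (nth _ _ _); rewrite /ot' -map_comp; apply/eq_in_map => j /=.
  rewrite (perm_mem perm_Is) mem_iota /= => lt_j.
  by rewrite (nth_map set0).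
have mem_os x : porbit s x \in os by rewrite mem_enum imset_f.
pose b x := index (porbit s x) os.
have lt_b x : (b x < size os)%N by rewrite index_mem.
have nth_b x : nth set0 os (b x) = porbit s x by rewrite nth_index.
pose C' x := nth set0 ot' (b x).
have C'_orbit x : exists y, C' x == porbit t y.
  have : C' x \in ot by rewrite -(perm_mem perm_ot) mem_nth ?sz_ot'.
  by rewrite mem_enum => /imsetP[y _ ->]; exists y.
pose psi x := xchoose (C'_orbit x).
have orb_psi x : porbit t (psi x) = C' x by apply/esym/eqP/(xchooseP (C'_orbit x)).
have rP x : exists y, porbit s x == porbit s y by exists x.
pose r x := xchoose (rP x).
have orb_r x : porbit s (r x) = porbit s x by apply/esym/eqP/(xchooseP (rP x)).
(* [xchoose] depends only on the predicate, so all points of an orbit share the base points [r] and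
   [psi]. *)
have r_eq x y : porbit s x = porbit s y -> r x = r y.
  by move=> e; rewrite /r; apply: eq_xchoose => z; rewrite e.
have psi_eq x y : porbit s x = porbit s y -> psi x = psi y.
  by move=> e; rewrite /psi; apply: eq_xchoose => z; rewrite /C' /b e.
have card_psi x : #|porbit t (psi x)| = #|porbit s (r x)|.
  by rewrite orb_psi orb_r /C' card_ot' ?nth_b.
have exm x : exists m, iter m s (r x) == x.
  have : x \in porbit s (r x) by rewrite orb_r porbit_id.
  by case/porbitP => i e; exists i; rewrite -permX -e.
pose m x := xchoose (exm x).
have mE x : iter (m x) s (r x) = x by apply/eqP/(xchooseP (exm x)).
(* The exponent matters only modulo the orbit length, which is the same for [s] and [t]. *)
pose g x := iter (m x) t (psi x).
have orb_g x : porbit t (g x) = C' x by rewrite /g -permX porbit_perm orb_psi.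
have g_inj : injective g.
  move=> x y e; have := congr1 (porbit t) e; rewrite !orb_g => /eqP.
  rewrite nth_uniq ?sz_ot' // => /eqP eb.
  have eo : porbit s x = porbit s y by rewrite -!nth_b eb.
  move/eqP: e; rewrite /g (psi_eq _ _ eo) eq_iter_porbit card_psi.
  by rewrite -eq_iter_porbit -{1}(r_eq _ _ eo) !mE => /eqP.
exists (perm g_inj); apply/permP => y; rewrite -[y](permKV (perm g_inj)).
move: ((perm g_inj)^-1%g y) => x.
have -> : (s ^ perm g_inj)%g (perm g_inj x) = perm g_inj (s x).
  by rewrite conjgE !permM permK.
rewrite !permE /g -[RHS]iterS.
have eo : porbit s (s x) = porbit s x by rewrite -[in LHS](expg1 s) porbit_perm.
rewrite (psi_eq _ _ eo); apply/eqP; rewrite eq_iter_porbit card_psi.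
by rewrite -eq_iter_porbit -{1}(r_eq _ _ eo) mE iterS mE.
Qed.


(** * Class sizes *)

Section ClassSize.

Local Open Scope nat_scope.

Variable T : finType.
Implicit Types (s v : {perm T}) (x y : T) (c mu nu : seq nat).

Lemma card_porbit_order s x : #|porbit s x| = fingraph.order s x.
Proof.
apply: eq_card => y; apply/porbitP/idP => [[i ->]|xy].
  by rewrite permX; apply: fconnect_iter.
by exists (findex s x y); rewrite permX iter_findex.
Qed.

Lemma fcycle_traject_porbit s x : fcycle s (traject s x #|porbit s x|).
Proof.
have := iter_porbit s x; case: #|porbit s x| => //= n iter_n.
by rewrite rcons_path fpath_traject /= last_traject -iterS [iter _ _ _]iter_n eqxx.
Qed.

(** The fallback to [id] makes the map injective for every list, so [cycle_perm] takes no proof of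
    uniqueness. *)
Definition cycle_fun (c : seq T) : T -> T := if uniq c then next c else id.

Lemma cycle_fun_inj (c : seq T) : injective (cycle_fun c).
Proof.
by rewrite /cycle_fun; case: ifP => [Uc|_ x y //]; exact: (can_inj (prev_next Uc)).
Qed.

Definition cycle_perm (c : seq T) : {perm T} := perm (@cycle_fun_inj c).

Lemma cycle_permE (c : seq T) x : uniq c -> cycle_perm c x = next c x.
Proof. by move=> Uc; rewrite permE /cycle_fun Uc. Qed.

Definition fixes (s : {perm T}) (c : seq T) := all (fun x => s x == x) c.

Section MulCycle.

Variables (c : seq T) (s : {perm T}).
Hypotheses (Uc : uniq c) (fix_c : fixes s c).
Local Notation v := (cycle_perm c * s)%g.

Lemma mul_cycle_in x : x \in c -> v x = next c x.
Proof.
move=> cx; rewrite permM cycle_permE //.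
by apply/eqP/(allP fix_c); rewrite mem_next.
Qed.

Lemma mul_cycle_out x : x \notin c -> v x = s x.
Proof. by move=> cx; rewrite permM cycle_permE // next_nth (negPf cx). Qed.

Lemma fcycle_mul_cycle : fcycle v c.
Proof.
have := cycle_next Uc; rewrite (@eq_in_cycle _ (mem c) _ (frel v)) //.
by move=> x y cx _; rewrite /= mul_cycle_in.
Qed.

Lemma card_porbit_mul_cycle_in x : x \in c -> #|porbit v x| = size c.
Proof.
by move=> cx; rewrite card_porbit_order (fingraph.order_cycle fcycle_mul_cycle Uc cx).
Qed.

Lemma fixes_out x : x \notin c -> s x \notin c.
Proof.
apply: contra => csx; have /eqP := allP fix_c _ csx.
by move/perm_inj => e; rewrite -e.
Qed.

Lemma card_porbit_mul_cycle_out x : x \notin c -> #|porbit v x| = #|porbit s x|.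
Proof.
move=> cx; apply: card_porbit_eq => a; rewrite -iter_porbit_dvd.
suff [-> _] : iter a v x = iter a s x /\ iter a s x \notin c by [].
elim: a => //= a [-> c_a]; split; last exact: fixes_out.
exact: mul_cycle_out.
Qed.

Lemma card_porbit_fixed x : x \in c -> #|porbit s x| = 1.
Proof.
move=> cx; apply: card_porbit_eq => a; rewrite dvd1n; apply/eqP.
by elim: a => //= a ->; apply/eqP/(allP fix_c).
Qed.

Lemma nb_in_cycles_mul_cycle i : 1 < i ->
  nb_in_cycles v i = (i == size c) * size c + nb_in_cycles s i.
Proof.
move=> i1; rewrite /nb_in_cycles -(cardsID [set x in c]); congr (_ + _).
  have [->|ne_i] := eqVneq i (size c).
    rewrite mul1n; transitivity #|c|; last exact/card_uniqP.
    apply: eq_card => x; rewrite !inE.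
    by case cx: (x \in c); rewrite ?andbF // card_porbit_mul_cycle_in ?eqxx.
  apply/eqP; rewrite cards_eq0; apply/eqP/setP => x; rewrite !inE.
  case cx: (x \in c); rewrite ?andbF // card_porbit_mul_cycle_in //.
  by rewrite eq_sym (negPf ne_i).
apply: eq_card => x; rewrite !inE; case cx: (x \in c) => /=.
  by rewrite card_porbit_fixed // ltn_eqF.
by rewrite card_porbit_mul_cycle_out ?cx.
Qed.

(** The attached cycle is recovered from the product and its first point; this gives injectivity in
    the double count of [nb_type_cons]. *)
Lemma mul_cycle_traject x (p : seq T) : c = x :: p -> c = traject v x (size c).
Proof.
move=> def_c; have := fcycle_mul_cycle; rewrite def_c /= rcons_path.
by case/andP=> f_p _; congr cons; apply: fpathE.
Qed.

End MulCycle.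

(* Fixed points are not recorded: [mu] lists the lengths of the other cycles. *)
Definition has_type s mu :=
  [forall i : 'I_#|T|.+1, (1 < i) ==> (nb_in_cycles s i == i * count_mem (i : nat) mu)].

Lemma count_mem_big mu i : sumn mu < i -> count_mem i mu = 0.
Proof.
by move=> lt_i; apply/count_memPn/negP => /mem_le_sumn; rewrite leqNgt lt_i.
Qed.

Lemma has_typeP s mu : sumn mu <= #|T| ->
  reflect (forall i, 1 < i -> nb_in_cycles s i = i * count_mem i mu) (has_type s mu).
Proof.
move=> le_mu; apply: (iffP forallP) => H i; last by apply/implyP => i1; rewrite H.
have [lt_i|le_i] := ltnP i #|T|.+1.
  by move=> i1; apply/eqP; have /implyP := H (Ordinal lt_i); apply.
by rewrite nb_in_cycles_big // count_mem_big ?muln0 // (leq_ltn_trans le_mu).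
Qed.

Lemma sumn_count_mem mu K : sumn mu < K -> sumn mu = \sum_(i < K) i * count_mem (i : nat) mu.
Proof.
elim: mu => [|x mu IHmu] /= lt_K; first by rewrite big1 // => i _; rewrite muln0.
under eq_bigr => i _ do rewrite mulnDr.
rewrite big_split /= -IHmu ?(leq_ltn_trans _ lt_K) ?leq_addl //.
have lt_x : x < K by rewrite (leq_ltn_trans _ lt_K) ?leq_addr.
rewrite (bigD1 (Ordinal lt_x)) //= eqxx muln1 big1 ?addn0 // => i.
by rewrite -val_eqE /= eq_sym => /negPf ->; rewrite muln0.
Qed.

Lemma sum_nb_in_cycles_wide s K : #|T| < K -> \sum_(i < K) nb_in_cycles s i = #|T|.
Proof.
move=> lt_K; rewrite -[RHS](sum_nb_in_cycles s).
rewrite [RHS](big_ord_widen K (nb_in_cycles s)) // [RHS]big_mkcond /=.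
by apply: eq_bigr => i _; case: leqP => // /nb_in_cycles_big.
Qed.

Lemma nb_fixed_has_type s mu : all (ltn 1) mu -> sumn mu <= #|T| ->
  has_type s mu -> nb_in_cycles s 1 + sumn mu = #|T|.
Proof.
move=> mu1 le_mu /(has_typeP _ le_mu) type_s.
pose K := #|T|.+2.
rewrite (@sumn_count_mem mu K) ?ltnS ?leqW // -(@sum_nb_in_cycles_wide s K) //.
have lt1 : 1 < K by [].
rewrite (bigD1 (Ordinal lt1)) //= [RHS](bigD1 (Ordinal lt1)) //=.
have -> : count_mem 1 mu = 0.
  by apply/count_memPn/negP => /(allP mu1).
rewrite muln0 add0n; congr (_ + _); apply: eq_bigr => i.
rewrite -val_eqE /= => i1; case: (posnP i) => [->|i0].
  by rewrite nb_in_cycles0 mul0n.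
by rewrite type_s //; lia.
Qed.

Lemma card_fixed s : #|[set x | s x == x]| = nb_in_cycles s 1.
Proof.
apply: eq_card => x; rewrite !inE -[s x]/(iter 1 s x) iter_porbit_dvd dvdn1.
by [].
Qed.

Definition nb_type mu := #|[set s : {perm T} | has_type s mu]|.

(* Both sides count pairs [(v, x)] where [v] has type [l :: nu] and [x] lies in
   an [l]-cycle of [v]: the cycle through [x] is an arbitrary uniq [l]-tuple of
   fixed points of the remaining factor of [v], which has type [nu]. *)
Lemma nb_type_cons l nu : 1 < l -> all (ltn 1) nu -> l + sumn nu <= #|T| ->
  nb_type (l :: nu) * (l * (count_mem l nu).+1) =
    nb_type nu * (#|T| - sumn nu) ^_ l.
Proof.
move=> l1 nu1 le_nu.
have le_nu' : sumn nu <= #|T| by rewrite (leq_trans _ le_nu) ?leq_addl.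
pose A := [set p : {perm T} * T | has_type p.1 (l :: nu) && (#|porbit p.1 p.2| == l)].
pose B := [set q : l.-tuple T * {perm T} |
  [&& uniq q.1, has_type q.2 nu & fixes q.2 q.1]].
have cardA : #|A| = nb_type (l :: nu) * (l * (count_mem l nu).+1).
  rewrite -sum1_card (eq_bigl (fun p => has_type p.1 (l :: nu) &&
    (#|porbit p.1 p.2| == l))) => [|p]; last by rewrite inE.
  rewrite -(pair_big_dep (fun v => has_type v (l :: nu))
    (fun v x => #|porbit v x| == l) (fun _ _ => 1)) /=.
  rewrite /nb_type -sum1_card big_distrl /=.
  apply: eq_big => [v|v type_v]; first by rewrite inE.
  rewrite mul1n sum1_card; transitivity (nb_in_cycles v l).
    by apply: eq_card => x; rewrite !inE.
  by rewrite (has_typeP v (mu := l :: nu) le_nu type_v) //= eqxx add1n.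
have cardB : #|B| = nb_type nu * (#|T| - sumn nu) ^_ l.
  rewrite -sum1_card (eq_bigl (fun q : l.-tuple T * {perm T} => true &&
    [&& uniq q.1, has_type q.2 nu & fixes q.2 q.1])) => [|q]; last by rewrite inE.
  rewrite -(pair_big_dep xpredT (fun (c : l.-tuple T) v =>
    [&& uniq c, has_type v nu & fixes v c]) (fun _ _ => 1)) /=.
  rewrite (exchange_big_dep (fun v => has_type v nu)) /=; last by move=> c v _ /and3P[].
  rewrite /nb_type -sum1_card big_distrl /=.
  apply: eq_big => [v|v type_v]; first by rewrite inE.
  (* [v] has [#|T| - sumn nu] fixed points, and the falling factorial counts their duplicate-free
     [l]-tuples. *)
  rewrite mul1n sum1_card -(nb_fixed_has_type nu1 le_nu' type_v) addnK.
  rewrite -card_fixed cardsE -card_uniq_tuples; apply: eq_card => c.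
  by rewrite !inE type_v /= andbC.
rewrite -cardA -cardB.
have l0 : 0 < l by apply: ltnW.
pose hd (c : l.-tuple T) := tnth c (Ordinal l0).
have hdE (c : l.-tuple T) : exists p : seq T, tval c = hd c :: p.
  rewrite /hd (tnth_nth (tnth c (Ordinal l0))) /=.
  case: c (tnth _ _) => [[|x p] //=]; first by rewrite eq_sym gtn_eqF.
  by exists p.
(* [f] attaches the cycle and remembers its first point; its inverse reads the cycle as the
   trajectory of [x]. *)
pose f (q : l.-tuple T * {perm T}) := ((cycle_perm q.1 * q.2)%g, hd q.1).
have f_inj : {in B &, injective f}.
  move=> [c1 v1] [c2 v2]; rewrite !inE /= => /and3P[U1 _ fix1] /and3P[U2 _ fix2].
  rewrite /f /= => -[eq_v eq_h].
  have [p1 def1] := hdE c1; have [p2 def2] := hdE c2.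
  have eq_c : c1 = c2.
    apply: val_inj => /=; rewrite (mul_cycle_traject U1 fix1 def1).
    by rewrite (mul_cycle_traject U2 fix2 def2) !size_tuple eq_v eq_h.
  by rewrite eq_c in eq_v *; move/mulgI: eq_v => ->.
rewrite -(card_in_imset f_inj); apply: eq_card => -[v x].
apply/idP/imsetP => [|[[c s] + [-> ->]]]; rewrite !inE /=; last first.
  case/and3P=> Uc type_s fix_s; have [p def_c] := hdE c.
  rewrite (card_porbit_mul_cycle_in Uc fix_s) ?size_tuple ?eqxx ?andbT; last first.
    by rewrite def_c mem_head.
  apply/has_typeP => // i i1; rewrite (nb_in_cycles_mul_cycle Uc fix_s) //.
  rewrite (has_typeP s le_nu' type_s) //= size_tuple mulnDr eq_sym.
  by case: eqP => [->|_]; rewrite ?muln1 ?mul1n ?muln0.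
case/andP=> type_v /eqP card_x.
have Uc : uniq (traject v x l) by rewrite -card_x uniq_traject_porbit.
pose c := Tuple (introT eqP (size_traject v x l)).
pose s := ((cycle_perm c)^-1 * v)%g.
have def_v : v = (cycle_perm c * s)%g by rewrite mulKVg.
have v_next y : y \in tval c -> v y = next (tval c) y.
  have cyc : fcycle v c.
    by rewrite /c /= -card_x fcycle_traject_porbit.
  by move=> cy; apply/eqP/(next_cycle cyc).
have fix_s : fixes s c.
  apply/allP => y cy; apply/eqP.
  have c_py : prev (tval c) y \in tval c by rewrite mem_prev.
  rewrite -[y in LHS](next_prev Uc) -(cycle_permE _ Uc) -permM -def_v.
  by rewrite v_next // next_prev.
exists (c, s); rewrite ?inE /= /f /= -?def_v; last first.
  by congr pair; rewrite /hd (tnth_nth x) /= nth_traject.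
rewrite Uc fix_s andbT /=; apply/has_typeP => // i i1.
have := nb_in_cycles_mul_cycle Uc fix_s i1.
rewrite -def_v (has_typeP v (mu := l :: nu) le_nu type_v) //= size_traject mulnDr eq_sym.
by case: eqP => [->|_]; rewrite ?muln1 ?mul1n ?muln0 => /addnI.
Qed.

Lemma zpart_wide mu K : sumn mu <= K ->
  zpart mu = \prod_(1 <= i < K.+1) (i ^ count_mem i mu * (count_mem i mu)`!).
Proof.
move=> le_K; rewrite /zpart [RHS](big_cat_nat _ (n := (sumn mu).+1)) //=.
rewrite [X in _ * X]big_nat_cond [X in _ * X]big1 ?muln1 // => i.
by rewrite andbT => /andP[lt_i _]; rewrite count_mem_big // expn0 fact0.
Qed.

Lemma zpart_cons l nu : 0 < l -> zpart (l :: nu) = l * (count_mem l nu).+1 * zpart nu.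
Proof.
move=> l0; rewrite (zpart_wide (leqnn _)) /=.
rewrite (@zpart_wide nu (l + sumn nu)) ?leq_addl //.
have l_in : l \in index_iota 1 (l + sumn nu).+1 by rewrite mem_index_iota l0 ltnS leq_addr.
rewrite (bigD1_seq l) ?iota_uniq //= [in RHS](bigD1_seq l) ?iota_uniq //= eqxx add1n.
rewrite expnS factS; under eq_bigr => i ne_i do
  rewrite eq_sym (negPf ne_i) add0n.
move: (l ^ _) ((count_mem l nu)`!) => a b; move: (\prod_(_ <- _ | _) _) => d.
by rewrite !mulnA; congr (_ * _ * _); lia.
Qed.

(** The size of a conjugacy class, in a form without division. The factorial of the number of fixed
    points is the source of (k-j)! in the final formula. *)
Lemma card_type mu : all (ltn 1) mu -> sumn mu <= #|T| ->
  nb_type mu * zpart mu * (#|T| - sumn mu)`! = #|T|`!.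
Proof.
elim: mu => [|l nu IHnu] /=.
  move=> _ _; rewrite subn0 /zpart big_geq // muln1.
  suff -> : nb_type [::] = 1 by rewrite mul1n.
  rewrite /nb_type (_ : [set s | _] = [set 1%g]) ?cards1 //.
  apply/setP => s; rewrite !inE; apply/idP/eqP => [type_s|->]; last first.
    apply/has_typeP => // i i1; rewrite muln0; apply/eqP; rewrite cards_eq0.
    apply/eqP/setP => x; rewrite !inE (@card_porbit_eq _ _ _ 1) ?ltn_eqF // => a.
    by rewrite dvd1n; elim: a => [|a /eqP IHa] /=; rewrite ?IHa ?perm1 eqxx.
  have := @nb_fixed_has_type s [::] isT isT type_s; rewrite /= addn0 -card_fixed.
  move/eqP; rewrite -cardsT; have sub := subsetT [set x | s x == x].
  rewrite (subset_leqif_card sub) => /subsetP all_fix.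
  by apply/permP => x; have := all_fix x (in_setT _); rewrite inE perm1 => /eqP.
case/andP=> l1 nu1 le_nu.
have le_nu' : sumn nu <= #|T| by rewrite (leq_trans _ le_nu) ?leq_addl.
rewrite zpart_cons ?(ltnW l1) // mulnA nb_type_cons //.
have le_l : l <= #|T| - sumn nu by rewrite leq_subRL // addnC.
rewrite -(IHnu nu1 le_nu') -(ffact_fact le_l) addnC subnDA -!mulnA.
by congr (_ * _); rewrite mulnCA.
Qed.

End ClassSize.

(** * Counting square roots by long cycles *)

Section LongPart.

Variable T : finType.
Implicit Types (u v s : {perm T}) (x : T) (J : {set T}).

Definition fix_on J s := [forall x, (x \in J) ==> (s x == x)].

Lemma fix_onP J s : reflect {in J, forall x, s x = x} (fix_on J s).
Proof.
apply: (iffP forallP) => [H x xJ|H x]; last by apply/implyP => /H ->.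
by apply/eqP; have /implyP := H x; apply.
Qed.

Lemma card_involutions_fix J :
  #|[set s : {perm T} | (s * s == 1)%g && fix_on J s]| = nb_involutions #|~: J|.
Proof.
have inj_val : injective (@enum_val T (mem (~: J))) by apply: enum_val_inj.
rewrite /nb_involutions -(card_imset _ (@perm_ext_inj _ _ _ inj_val)).
apply: eq_card => s; rewrite inE; apply/andP/imsetP => [[/eqP ss /fix_onP fixs]|].
  have [i|r def_s] := perm_ext_onto inj_val (v := s).
    move=> out_i; apply: fixs; apply: contraR out_i => notJ.
    have cJ : i \in ~: J by rewrite inE.
    by apply/codomP; exists (enum_rank_in cJ i); rewrite enum_rankK_in.
  exists r; rewrite // inE; apply/eqP/(@perm_ext_inj _ _ _ inj_val).
  by rewrite perm_extM perm_ext1 -def_s.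
case=> r; rewrite inE => /eqP rr ->; rewrite -perm_extM rr perm_ext1 eqxx.
split=> //; apply/fix_onP => x xJ; apply: perm_ext_out.
by apply/codomP => -[i def_x]; have := enum_valP i; rewrite -def_x inE xJ.
Qed.

Definition no_swap v := [forall x, (v (v x) == x) ==> (v x == x)].

Definition moved v := [set x | v x != x].

Definition long_fun u x := if u (u x) == x then x else u x.

Lemma long_fun_inj u : injective (long_fun u).
Proof.
move=> x y; rewrite /long_fun; case: eqP => ux; case: eqP => uy //.
- by move=> e; case: uy; rewrite e in ux; apply/(@perm_inj _ u).
- by move=> e; case: ux; rewrite -e in uy; apply/(@perm_inj _ u).
exact: perm_inj.
Qed.

Definition long_part u : {perm T} := perm (@long_fun_inj u).

Lemma long_partE u x : long_part u x = if u (u x) == x then x else u x.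
Proof. by rewrite permE. Qed.

Lemma long_part_sqr u : (long_part u * long_part u = u * u)%g.
Proof.
apply/permP => x; rewrite !permM !long_partE.
case: (u (u x) =P x) => [-> //|ux]; first by rewrite ifT //; apply/eqP.
by rewrite (inj_eq perm_inj); case: eqP.
Qed.

Lemma long_part_no_swap u : no_swap (long_part u).
Proof.
apply/forallP => x; apply/implyP; rewrite -permM long_part_sqr permM long_partE.
by move=> ->.
Qed.

Lemma long_part_mul v s : no_swap v ->
  (long_part (v * s) == v) = (s * s == 1)%g && fix_on (moved v) s.
Proof.
move=> /forallP nsw; apply/eqP/andP => [def_v|[/eqP ss /fix_onP fixs]].
  have fixs : fix_on (moved v) s.
    apply/fix_onP => y; rewrite inE => vy.
    (* A moved point is [v x] with [x] moved, and there the hypothesis on long parts reads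
       [s (v x) = v x]. *)
    rewrite -[y](permKV v); set x := (v^-1)%g y.
    have vx : v x != x.
      by apply: contra vy => /eqP e; rewrite -(permKV v y) -/x !e.
    have := congr1 (fun p : {perm T} => p x) def_v.
    rewrite /= long_partE; case: eqP => _; last by rewrite permM.
    by move/eqP; rewrite eq_sym (negPf vx).
  split=> //; apply/eqP/permP => x; rewrite permM perm1.
  have [xv|xv] := boolP (x \in moved v).
    by move/fix_onP: fixs => fixs; rewrite !fixs.
  have vx : v x = x by apply/eqP; rewrite inE negbK in xv.
  have sx : v (s x) = s x.
    apply/eqP/negPn/negP => sxv; have : s x \in moved v by rewrite inE.
    move/(fix_onP _ _ fixs)/perm_inj => e; rewrite e in sxv.
    by rewrite vx eqxx in sxv.
  have := congr1 (fun p : {perm T} => p x) def_v.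
  rewrite /= long_partE !permM vx sx; case: eqP => // ne e.
  by rewrite e e in ne.
apply/permP => x; rewrite long_partE !permM.
have [xv|xv] := boolP (x \in moved v).
  have vM y : y \in moved v -> v y \in moved v.
    by rewrite !inE (inj_eq perm_inj).
  have vxv := vM _ xv.
  rewrite (fixs _ vxv).
  have vvx : v (v x) != x.
    apply/negP => vvx; have := nsw x; rewrite vvx /=.
    by rewrite inE in xv; rewrite (negPf xv).
  by rewrite (fixs _ (vM _ vxv)) (negPf vvx).
have vx : v x = x by apply/eqP; rewrite inE negbK in xv.
have sx : v (s x) = s x.
  apply/eqP/negPn/negP => sxv; have : s x \in moved v by rewrite inE.
  by move/fixs/perm_inj => e; rewrite e vx eqxx in sxv.
by rewrite vx sx -permM ss perm1 eqxx.
Qed.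

Lemma card_long_part v : no_swap v ->
  #|[set u | long_part u == v]| = nb_involutions (#|T| - #|moved v|).
Proof.
move=> nsw; have <- : #|~: moved v| = (#|T| - #|moved v|)%N.
  by rewrite cardsCs setCK.
rewrite -card_involutions_fix -(card_preimset _ (mulgI v)).
by apply: eq_card => s; rewrite !inE long_part_mul.
Qed.

Lemma card_sqrt w : #|[set u | (u * u)%g == w]| =
  (\sum_(v | no_swap v && ((v * v)%g == w)) nb_involutions (#|T| - #|moved v|))%N.
Proof.
rewrite -sum1_card.
rewrite (partition_big long_part (fun v => no_swap v && ((v * v)%g == w))) /=.
  apply: eq_bigr => v /andP[nsw /eqP vv]; rewrite -(card_long_part nsw) -sum1_card.
  apply: eq_bigl => u; rewrite !inE.
  case: (long_part u =P v) => [e|_]; last by rewrite andbF.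
  by rewrite andbT -long_part_sqr e vv eqxx.
by move=> u; rewrite inE => uu; rewrite long_part_no_swap long_part_sqr.
Qed.

End LongPart.

(** The long part of a root in S_n already lies in S_k: a point outside ['I_k] is fixed by the
    square, hence by a permutation without 2-cycles. Only the involution factor sees [n]. *)
Lemma nb_sqrt_no_swap k n (le_kn : (k <= n)%N) (w : 'S_k) :
  nb_sqrt le_kn w =
  (\sum_(v : 'S_k | no_swap v && ((v * v)%g == w)) nb_involutions (n - #|moved v|))%N.
Proof.
pose inj_w := @widen_ord_injective k n le_kn.
rewrite /nb_sqrt card_sqrt card_ord.
pose A := [set v : 'S_k | no_swap v && ((v * v)%g == w)].
have moved_w v : moved (widen_perm le_kn v) = widen_ord le_kn @: moved v.
  apply/setP => x; rewrite inE; apply/idP/imsetP => [|[i + ->]].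
    have [/codomP[i ->]|out_x] := boolP (x \in codom (widen_ord le_kn)).
      by rewrite perm_extE (inj_eq inj_w) => vi; exists i; rewrite ?inE.
    by rewrite perm_ext_out ?eqxx.
  by rewrite inE perm_extE (inj_eq inj_w).
rewrite (eq_bigl (fun V => V \in widen_perm le_kn @: A)) => [|V]; last first.
  apply/andP/imsetP => [[/forallP nsw /eqP VV]|].
    have [x|v def_V] := perm_ext_onto inj_w (v := V).
      move=> out_x; apply/eqP; have /implyP := nsw x; apply.
      by rewrite -permM VV perm_ext_out.
    exists v; last exact: def_V.
    rewrite inE; apply/andP; split.
      apply/forallP => i; have := nsw (widen_ord le_kn i).
      by rewrite def_V !perm_extE !(inj_eq inj_w).
    by apply/eqP/(@perm_ext_inj _ _ _ inj_w); rewrite perm_extM -def_V.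
  case=> v; rewrite inE => /andP[/forallP nsw /eqP vv] ->.
  split; last by rewrite -perm_extM vv.
  apply/forallP => x.
  have [/codomP[i ->]|out_x] := boolP (x \in codom (widen_ord le_kn)).
    by rewrite !perm_extE !(inj_eq inj_w).
  by rewrite !(perm_ext_out _ _ out_x) eqxx.
rewrite big_imset /=; last by move=> u v _ _; apply: perm_ext_inj.
apply: eq_big => [v|v _]; first by rewrite inE.
by rewrite moved_w card_imset.
Qed.

(** * Permutations without 2-cycles, sorted by type *)

Section TypeSum.

Local Open Scope nat_scope.

Variable k : nat.
Implicit Types (v : 'S_k) (mu : seq nat).

Lemma moved_fixed v : #|moved v| + nb_in_cycles v 1 = k.
Proof.
rewrite -card_fixed -[RHS](card_ord k) -(cardC (mem (moved v))); congr (_ + _).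
by apply: eq_card => x; rewrite !inE negbK.
Qed.

Lemma no_swapE v : no_swap v = (nb_in_cycles v 2 == 0).
Proof.
have swapE x : #|porbit v x| == 2 = (v (v x) == x) && (v x != x).
  have -> : (v (v x) == x) = (iter 2 v x == x) by [].
  have -> : (v x == x) = (iter 1 v x == x) by [].
  rewrite !iter_porbit_dvd dvdn1; have := card_porbit_gt0 v x.
  by case: #|_| => [|[|[|m]]] //= _; apply/esym/negP => /andP[/dvdn_leq]; case.
rewrite cards_eq0; apply/forallP/eqP => [nsw|no2 x].
  apply/setP => x; rewrite !inE swapE; have := nsw x.
  by case: (v (v x) == x) => //= ->.
have := in_set0 x; rewrite -no2 inE swapE.
by case: (v (v x) == x) => //= /negbFE.
Qed.

Definition long_cycles v := [seq i <- cycle_type v | 1 < i].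

Lemma count_long_cycles v i : 1 < i ->
  i * count_mem i (long_cycles v) = nb_in_cycles v i.
Proof.
move=> i1; rewrite nb_in_cycles_porbits mulnC; congr (_ * _).
rewrite count_filter; apply: eq_count => j /=.
by case: eqP => // ->; rewrite i1.
Qed.

Lemma sumn_long_cycles v : sumn (long_cycles v) = #|moved v|.
Proof.
apply: (@addIn (nb_in_cycles v 1)); rewrite moved_fixed.
pose K := (sumn (long_cycles v) + k).+2.
rewrite (@sumn_count_mem _ K) ?ltnS ?leqW ?leq_addr //.
rewrite -[RHS](card_ord k).
rewrite -(@sum_nb_in_cycles_wide _ v K) ?card_ord ?ltnS ?leqW ?leq_addl //.
have lt1 : 1 < K by [].
rewrite addnC [RHS](bigD1 (Ordinal lt1)) //= (bigD1 (Ordinal lt1)) //=.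
congr (_ + _).
have -> : count_mem 1 (long_cycles v) = 0.
  by apply/count_memPn; rewrite mem_filter.
rewrite add0n; apply: eq_bigr => i; rewrite -val_eqE /= => i1.
have [i0|i0] := posnP i; first by rewrite i0 nb_in_cycles0.
by rewrite count_long_cycles //; lia.
Qed.

Definition no12 mu := (count_mem 1 mu == 0) && (count_mem 2 mu == 0).

Lemma no12_gt1 j (mu : intpartn j) : no12 mu -> all (ltn 1) mu.
Proof.
case/andP=> /eqP/count_memPn mu1 _; apply/allP => x xmu.
have x0 : x != 0 by apply: contraNneq (part_notin0 mu) => <-.
have x1 : x != 1 by apply: contraNneq mu1 => <-.
by rewrite /= ltn_neqAle eq_sym x1 lt0n.
Qed.

Lemma has_type_moved v j (mu : intpartn j) : j <= k ->
  no12 mu -> has_type v mu -> #|moved v| = j.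
Proof.
move=> le_j mu12 type_v; apply: (@addIn (nb_in_cycles v 1)).
have := nb_fixed_has_type (no12_gt1 mu12) _ type_v.
by rewrite sumn_part card_ord addnC moved_fixed => ->.
Qed.

(** A permutation without 2-cycles has exactly one type with all parts at least 3, namely the sorted
    list of its long cycles. This turns the indicator of [no_swap] into the double sum of the
    theorem. *)
Lemma sum_has_type v :
  \sum_(j < k.+1) \sum_(mu : intpartn j) (no12 mu && has_type v mu) = no_swap v.
Proof.
have lt_m : #|moved v| < k.+1 by rewrite ltnS -[leqRHS](moved_fixed v) leq_addr.
(* By [has_type_moved], only [j = #|moved v|] contributes. *)
rewrite (bigD1 (Ordinal lt_m)) //= [X in _ + X]big1 ?addn0 => [|j ne_j]; last first.
  rewrite big1 // => mu _; apply/eqP; rewrite eqb0; apply: contra ne_j.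
  case/andP=> mu12 /(has_type_moved (leq_ord j) mu12) e.
  by apply/eqP/val_inj; rewrite /= e.
have le_m : #|moved v| <= #|'I_k| by rewrite card_ord.
apply: sum_pred_unique => [mu nu|].
  case/andP=> mu12 /has_typeP type_mu /andP[nu12 /has_typeP type_nu].
  rewrite !sumn_part in type_mu type_nu.
  apply: val_inj; apply: (sorted_eq (leT := geq)).
  - by move=> x y z; rewrite /geq /= => H1 H2; apply: leq_trans H2 H1.
  - by move=> x y; rewrite /geq /= andbC -eqn_leq => /eqP.
  - exact: part_sorted.
  - exact: part_sorted.
  apply/allP => i _ /=; apply/eqP.
  have [i1|] := ltnP 1 i.
    apply/eqP; rewrite -(eqn_pmul2l (ltnW i1)).
    by rewrite -type_mu ?type_nu.
  case: i => [|[|//]] _.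
    by rewrite !(count_memPn _) ?part_notin0.
  by case/andP: mu12 => /eqP -> _; case/andP: nu12 => /eqP -> _.
apply: (iffP idP) => [nsw|[mu /andP[mu12 /has_typeP type_mu]]]; last first.
  rewrite no_swapE type_mu ?sumn_part //.
  by case/andP: mu12 => _ /eqP ->.
have perm_sort := permEl (perm_sort geq (long_cycles v)).
have sum_mu : sumn (sort geq (long_cycles v)) = #|moved v|.
  by rewrite -sumn_long_cycles; apply: perm_sumn.
have part_mu : is_part (sort geq (long_cycles v)) &&
    (sumn (sort geq (long_cycles v)) == #|moved v|).
  rewrite sum_mu eqxx andbT; apply/andP; split.
    by apply: sort_sorted => x y; apply: leq_total.
  by rewrite (perm_mem perm_sort) mem_filter.
exists (IntPartn part_mu); rewrite /=.
have countE i : count_mem i (sort geq (long_cycles v)) = count_mem i (long_cycles v).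
  by move/seq.permP: perm_sort => ->.
apply/andP; split.
  rewrite /no12 !countE; apply/andP; split.
    by apply/eqP/count_memPn; rewrite mem_filter.
  by rewrite -(eqn_pmul2l (isT : 0 < 2)) count_long_cycles // -no_swapE.
apply/has_typeP => [|i i1]; first by rewrite sum_mu.
by rewrite countE count_long_cycles.
Qed.

Lemma count_square_type mu i : count_mem i (square_type mu) =
  odd i * count_mem i mu + 2 * count_mem i.*2 mu.
Proof.
elim: mu => [|p mu IHmu]; first by rewrite !muln0.
rewrite /square_type /= count_cat -/(square_type mu) IHmu.
suff -> : count_mem i (if odd p then [:: p] else [:: p./2; p./2]) =
    odd i * (p == i) + 2 * (p == i.*2).
    by rewrite /= !mulnDr addnACA.
case odd_p: (odd p) => /=; last first.
  have def_p : p = (p./2).*2 by rewrite even_halfK ?odd_p.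
  have -> : (p == i.*2) = (p./2 == i) by rewrite {1}def_p (inj_eq double_inj).
  case: (p =P i) => [e|_]; last by lia.
  by rewrite -e odd_p; lia.
have -> : (p == i.*2) = false.
  by apply/negP => /eqP e; rewrite e odd_double in odd_p.
by case: eqP => [<-|_]; rewrite ?odd_p; lia.
Qed.

Lemma cycle_type_sqr v j (mu : intpartn j) : j <= k -> no12 mu -> has_type v mu ->
  perm_eq (cycle_type (v * v)%g) (square_type mu ++ nseq (k - j) 1).
Proof.
move=> le_j mu12 type_v; have le_mu : sumn mu <= #|'I_k| by rewrite sumn_part card_ord.
apply/allP => i _ /=; apply/eqP.
have [->|i0] := posnP i.
  rewrite count_cat count_square_type count_nseq /= !mul0n.
  rewrite (count_memPn (part_notin0 mu)) muln0 /=; apply/count_memPn/mapP => -[C].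
  by rewrite mem_enum => /imsetP[x _ ->] /esym/eqP; rewrite (negPf (card_porbit_neq0 _ _)).
(* Multiplying by [i] replaces multiplicities of cycles by numbers of points. *)
apply/eqP; rewrite -(eqn_pmul2r i0) -nb_in_cycles_porbits nb_in_cycles_sqr.
rewrite count_cat count_square_type count_nseq /=.
have [/eqP mu1 /eqP mu2] := andP mu12.
have type_i := has_typeP v le_mu type_v.
have i2 : 1 < i.*2 by lia.
rewrite (type_i _ i2).
have [i1|i1] := ltnP 1 i.
  rewrite (type_i _ i1) (ltn_eqF i1) mul0n addn0 -mul2n mulnDl; apply/eqP.
  by congr (_ + _); rewrite -!mulnA; congr (_ * _); rewrite mulnC.
(* As [v] has no 2-cycle, the fixed points of [v * v] are the [k - j] fixed points of [v]. *)
have -> : i = 1 by lia.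
have := nb_fixed_has_type (no12_gt1 mu12) le_mu type_v.
rewrite sumn_part card_ord => /(canRL (addnK _)) ->.
by rewrite mu1 mu2 /= !muln0 !mul1n muln1 addn0.
Qed.

End TypeSum.

(** The permutation picked has the cycle type of [v * v], hence is conjugate to it; the default
    value 0 is never reached, [v * v] itself being a candidate. *)
Lemma specht_char_at_sqr k (a : intpartn k) (v : 'S_k) j (mu : intpartn j) :
    (j <= k)%N -> no12 mu -> has_type v mu ->
  specht_char_at a (square_type mu ++ nseq (k - j) 1%N) = specht_char a (v * v)%g.
Proof.
move=> le_j mu12 type_v; have type_vv := cycle_type_sqr le_j mu12 type_v.
rewrite /specht_char_at; case: pickP => [s type_s|/(_ (v * v)%g)]; last first.
  by rewrite type_vv.
have [g <-] := conj_of_cycle_type (perm_trans type_vv (etrans (perm_sym _ _) type_s)).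
by rewrite specht_char_class.
Qed.

Theorem theorem2p1 (k : nat) (alpha : intpartn k)
    (T : syt k) (hT : shape T = alpha) (n : nat) (hkn : (k <= n)%N) :
  (nb_syt_containing n T)%:R =
    \sum_(j < k.+1)
      (nb_involutions (n - j))%:R / ((k - j)`!)%:R *
      \sum_(mu : intpartn j | (count_mem 1%N mu == 0%N) && (count_mem 2%N mu == 0%N))
        (zpart mu)%:R^-1 *
        specht_char_at alpha (square_type mu ++ nseq (k - j) 1%N)
  :> algC.
Proof.
have {hT} <- : shape_part T = alpha by apply: val_inj.
rewrite (nb_syt_containing_sqrt hkn) /sqrt_mean; set a := shape_part T.
pose t (v : 'S_k) : algC := (nb_involutions (n - #|moved v|))%:R.
(* Roots are grouped by their long part [v], weighted by the number of involutions on the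
   [n - #|moved v|] remaining points. *)
have -> : \sum_w specht_char a w * (nb_sqrt hkn w)%:R =
    \sum_v (no_swap v)%:R * (specht_char a (v * v)%g * t v).
  transitivity (\sum_(v | no_swap v) specht_char a (v * v)%g * t v); last first.
    by rewrite big_mkcond; apply: eq_bigr => v _; case: ifP; rewrite ?mul1r ?mul0r.
  rewrite [RHS](partition_big (fun v => v * v)%g predT) //=; apply: eq_bigr => w _.
  rewrite nb_sqrt_no_swap natr_sum mulr_sumr.
  by apply: eq_bigr => v /andP[_ /eqP <-].
under eq_bigr => v _.
  rewrite -sum_has_type natr_sum mulr_suml.
  under eq_bigr => j _ do rewrite natr_sum mulr_suml.
  over.
rewrite exchange_big mulr_sumr; apply: eq_bigr => j _ /=.
rewrite exchange_big !mulr_sumr [RHS]big_mkcond; apply: eq_bigr => mu _ /=.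
rewrite -/(no12 mu); case mu12: (no12 mu); last first.
  by rewrite big1 ?mulr0 // => v _; rewrite mul0r.
have le_j : (j <= k)%N by rewrite -ltnS.
have -> : \sum_v (true && has_type v mu)%:R * (specht_char a (v * v)%g * t v) =
  (nb_type 'I_k mu)%:R * (specht_char_at a (square_type mu ++ nseq (k - j) 1%N)
    * (nb_involutions (n - j))%:R).
  rewrite /nb_type -sum1_card natr_sum mulr_suml [RHS]big_mkcond.
  apply: eq_bigr => v _; rewrite inE /=; case type_v: (has_type v mu); last by rewrite mul0r.
  by rewrite (specht_char_at_sqr _ _ mu12 type_v) // /t (has_type_moved _ mu12 type_v).
have le_mu : (sumn mu <= #|'I_k|)%N by rewrite sumn_part card_ord.
(* The class size is k! over [zpart mu] and (k-j)!, so the averaging factor 1/k! cancels. *)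
have := card_type (no12_gt1 mu12) le_mu; rewrite sumn_part card_ord => card_mu.
have k0 : ((k`!)%:R : algC) != 0 by rewrite pnatr_eq0 -lt0n fact_gt0.
move: k0; rewrite -card_mu !natrM !mulf_eq0 !negb_or => /andP[/andP[U0 z0] f0].
by field; rewrite U0 z0 f0.
Qed.
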